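(* Let $k$ be an algebraically closed field of characteristic $p>0$ and let $X/k$ be a normal, unirational projective variety. Then the local fundamental group scheme of $X$ is trivial: $\pi^{\mathrm{loc}}(X)=1$.
   Context: A projective variety $X/k$ is called unirational if there is a dominant, separable rational map $\mathbb{P}^n \dashrightarrow X$ for some $n\ge 1$ (separability is part of the definition). Let $F$ denote the absolute Frobenius morphism. A vector bundle $V$ on a projective variety $X$ over $k$ is called $F$-trivial if $(F^m)^*V$ is a trivial vector bundle for some $m\ge 1$. The $F$-trivial bundles on $X$, together with the fibre functor given by a $k$-point of $X$, form a neutral Tannakian category; the local fundamental group scheme $\pi^{\mathrm{loc}}(X)$ (introduced by Mehta and Subramanian) is the affine $k$-group scheme Tannaka-dual to it. In particular $\pi^{\mathrm{loc}}(X)=1$ means exactly that every $F$-trivial vector bundle on $X$ is trivial. *)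

(* Defs.v *)
(* Classical projective varieties over an algebraically closed field k, vector
   bundles on them presented by transition matrices, and the local fundamental
   group scheme as the Tannaka dual of the F-trivial bundles. *)
From mathcomp Require Import all_boot all_order all_algebra all_field.
From mathcomp Require Export fraction mpoly.
From mathcomp.real_closed Require Export mxtens.

Set Implicit Arguments.
Unset Strict Implicit.
Unset Printing Implicit Defensive.

Import GRing.Theory.
Local Open Scope ring_scope.

Section ProjectiveSpace.
Variables (k : fieldType) (N : nat).

Definition pspace := {L : {vspace 'rV[k]_N.+1} | \dim L == 1%N}.

(* One choice of homogeneous coordinates.  It only occurs in conditions that do
   not depend on the choice: vanishing of homogeneous polynomials, and ratios
   of homogeneous polynomials of the same degree. *)
Definition hcoord (x : pspace) : 'rV[k]_N.+1 := vpick (val x).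

Definition peval (f : {mpoly k[N.+1]}) (x : pspace) : k :=
  f.@[fun i => hcoord x 0 i].

Definition is_closed (Z : pspace -> Prop) : Prop :=
  exists S : {mpoly k[N.+1]} -> Prop,
    (forall f, S f -> exists d : nat, f \is d.-homog) /\
    (forall x, Z x <-> forall f, S f -> peval f x = 0).

Definition irreducible (X : pspace -> Prop) : Prop :=
  (exists x, X x) /\
  forall Z1 Z2, is_closed Z1 -> is_closed Z2 ->
    (forall x, X x -> Z1 x \/ Z2 x) ->
    (forall x, X x -> Z1 x) \/ (forall x, X x -> Z2 x).

Record variety := Variety {
  pts :> pspace -> Prop;
  pts_closed : is_closed pts;
  pts_irreducible : irreducible pts }.

Variable X : variety.

Definition open_in (U : pspace -> Prop) : Prop :=
  exists2 Z, is_closed Z & forall x, U x <-> X x /\ ~ Z x.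

(* The sections of O_X over U; only the values of f on U matter. *)
Definition regular (U : pspace -> Prop) (f : pspace -> k) : Prop :=
  forall x, U x -> exists (W : pspace -> Prop) (d : nat) (a b : {mpoly k[N.+1]}),
    [/\ open_in W, W x, a \is d.-homog, b \is d.-homog &
      forall y, W y -> U y -> peval b y != 0 /\ f y = peval a y / peval b y].

(* Elements of the function field k(X) are represented by pairs (U, f) with U
   a nonempty open subset and f regular on U; since X is irreducible, two pairs
   are the same rational function iff they agree on the overlap.  k(X) is the
   fraction field of every local ring O_{X,x}. *)
Definition integral_at (x : pspace) (U : pspace -> Prop) (f : pspace -> k) :=
  exists (n : nat) (W : pspace -> Prop) (a : 'I_n -> pspace -> k),
    [/\ open_in W, W x, (forall i, regular W (a i)) &
      forall y, U y -> W y -> f y ^+ n + \sum_(i < n) a i y * f y ^+ i = 0].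

Definition in_local_ring (x : pspace) (U : pspace -> Prop) (f : pspace -> k) :=
  exists (W : pspace -> Prop) (g : pspace -> k),
    [/\ open_in W, W x, regular W g & forall y, U y -> W y -> f y = g y].

Definition normal : Prop :=
  forall x, X x -> forall U f, open_in U -> (exists y, U y) -> regular U f ->
    integral_at x U f -> in_local_ring x U f.

End ProjectiveSpace.

Section SeparableExtensions.
Variable M : fieldType.
Implicit Types E L : M -> Prop.

Definition alg_indep E d (t : 'I_d -> M) : Prop :=
  forall a : {mpoly M[d]}, (forall m, E a@_m) -> a.@[t] = 0 -> a = 0.

(* The subfield E(t_1, ..., t_d) of M, for a subfield E. *)
Definition adjoin E d (t : 'I_d -> M) (z : M) : Prop :=
  exists a b : {mpoly M[d]},
    [/\ forall m, E a@_m, forall m, E b@_m, b.@[t] != 0 & z = a.@[t] / b.@[t]].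

Definition separable_alg E (z : M) : Prop :=
  exists q : {poly M}, [/\ forall i, E q`_i, separable_poly q & root q z].

(* For subfields E of L of M with L finitely generated over E (the only case
   used), the extension L / E is separable iff it is separably generated. *)
Definition separable_ext E L : Prop :=
  exists (d : nat) (t : 'I_d -> M),
    [/\ forall i, L (t i), alg_indep E t &
      forall z, L z -> separable_alg (adjoin E t) z].

End SeparableExtensions.

Section RationalMaps.
Variables (k : fieldType) (n N : nat) (X : variety k N).

(* A rational map from P^n to P^N is given by N + 1 homogeneous polynomials of
   the same degree, not all zero; phi_graph is its graph over the locus where
   they do not all vanish. *)
Variable phi : N.+1.-tuple {mpoly k[n.+1]}.

Definition phi_graph (x : pspace k n) (y : pspace k N) : Prop :=
  let v := \row_i peval (tnth phi i) x in
  v != 0 /\ val y = <[v]>%VS.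

Definition rational_map_to : Prop :=
  [/\ exists d : nat, forall i, tnth phi i \is d.-homog,
      exists i, tnth phi i != 0 &
      forall x y, phi_graph x y -> X y].

Definition dominant : Prop :=
  forall Z, is_closed Z -> (forall x y, phi_graph x y -> Z y) ->
  forall y, X y -> Z y.

(* k(P^n), the degree-0 homogeneous fractions. *)
Definition source_field (z : {fraction {mpoly k[n.+1]}}) : Prop :=
  exists (d : nat) (a b : {mpoly k[n.+1]}),
    [/\ a \is d.-homog, b \is d.-homog, b != 0 & z = tofrac a / tofrac b].

(* The image of k(X) in k(P^n) under pullback along a dominant phi: a / b is
   sent to a(phi) / b(phi), and b(phi) != 0 iff b is not identically 0 on X. *)
Definition pulled_back_field (z : {fraction {mpoly k[n.+1]}}) : Prop :=
  exists (d : nat) (a b : {mpoly k[N.+1]}),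
    [/\ a \is d.-homog, b \is d.-homog, comp_mpoly phi b != 0 &
        z = tofrac (comp_mpoly phi a) / tofrac (comp_mpoly phi b)].

Definition separable_map : Prop := separable_ext pulled_back_field source_field.

End RationalMaps.

Definition unirational (k : fieldType) (N : nat) (X : variety k N) : Prop :=
  exists (n : nat) (phi : N.+1.-tuple {mpoly k[n.+1]}),
    [/\ (1 <= n)%N, rational_map_to X phi, dominant X phi & separable_map phi].

Section OpenSets.
Variables (k : fieldType) (N : nat) (X : variety k N).
Implicit Types (U W : pspace k N -> Prop).

Lemma open_in_full : open_in X X.
Proof.
exists (fun _ => False); last by move=> x; split=> [Xx|[]//]; split.
exists (fun f => f = 1); split=> [f ->|x]; first by exists 0%N; apply: dhomog1.
split=> // /(_ 1 erefl); rewrite /peval meval1 => /eqP.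
by rewrite oner_eq0.
Qed.

Lemma open_inI U W : open_in X U -> open_in X W ->
  open_in X (fun x => U x /\ W x).
Proof.
move=> [Z1 [S1 [h1 e1]] u1] [Z2 [S2 [h2 e2]] u2].
exists (fun x => forall f g, S1 f -> S2 g -> peval (f * g) x = 0).
  exists (fun h => exists f g, [/\ S1 f, S2 g & h = f * g]); split.
    move=> _ [f [g [/h1[d1 hf] /h2[d2 hg] ->]]].
    by exists (d1 + d2)%N; apply: dhomogM.
  move=> x; split=> [H _ [f [g [Sf Sg ->]]]|H f g Sf Sg]; first exact: H.
  by apply: H; exists f, g.
move=> x; rewrite u1 u2; split.
  move=> [[Xx n1] [_ n2]]; split=> // H; apply: n1; apply/e1 => f Sf.
  apply/eqP/negP => nf; apply: n2; apply/e2 => g Sg.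
  have /eqP := H f g Sf Sg; rewrite /peval mevalM mulf_eq0.
  by case/orP => [/nf //|/eqP].
move=> [Xx H]; split; split=> //.
  by move/e1=> z1; apply: H => f g Sf Sg; rewrite /peval mevalM [X in X * _]z1 ?mul0r.
by move/e2=> z2; apply: H => f g Sf Sg; rewrite /peval mevalM [X in _ * X]z2 ?mulr0.
Qed.

Lemma regular_sub U W (f : pspace k N -> k) :
  (forall x, W x -> U x) -> regular X U f -> regular X W f.
Proof.
move=> sWU rf x /sWU/rf[V [d [a [b [oV Vx ha hb H]]]]].
by exists V, d, a, b; split=> // y Vy /sWU; apply: H.
Qed.

Lemma regular_const U (c : k) :
  (forall x, U x -> X x) -> regular X U (fun=> c).
Proof.
move=> sUX x /sUX Xx; exists X, 0%N, (c *: 1), 1.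
split=> //; [exact: open_in_full|exact/dhomogZ/dhomog1|exact: dhomog1|].
by move=> y _ _; rewrite /peval mevalZ !meval1 oner_eq0 divr1 mulr1.
Qed.

Lemma regularM U (f g : pspace k N -> k) :
  regular X U f -> regular X U g -> regular X U (fun x => f x * g x).
Proof.
move=> rf rg x Ux.
have [V1 [d1 [a1 [b1 [o1 v1 ha1 hb1 H1]]]]] := rf x Ux.
have [V2 [d2 [a2 [b2 [o2 v2 ha2 hb2 H2]]]]] := rg x Ux.
exists (fun y => V1 y /\ V2 y), (d1 + d2)%N, (a1 * a2), (b1 * b2).
split=> //; [exact: open_inI|exact: dhomogM|exact: dhomogM|].
move=> y [/H1 h1 /H2 h2] Uy; have [n1 ->] := h1 Uy; have [n2 ->] := h2 Uy.
by rewrite /peval !mevalM mulf_neq0 // invfM mulrACA.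
Qed.

Lemma regularX U (f : pspace k N -> k) m : (forall x, U x -> X x) ->
  regular X U f -> regular X U (fun x => f x ^+ m).
Proof.
move=> sUX rf; elim: m => [|m IHm]; first exact: regular_const.
move=> x Ux; have [V [d [a [b [oV Vx ha hb H]]]]] := regularM rf IHm Ux.
by exists V, d, a, b; split=> // y Vy Uy; rewrite exprS; apply: H.
Qed.

Lemma open_in_sub U x : open_in X U -> U x -> X x.
Proof. by case=> Z _ uE /uE[]. Qed.

End OpenSets.

#[local] Obligation Tactic := idtac.

Section VectorBundles.
Variables (k : fieldType) (N : nat) (X : variety k N).

(* A vector bundle on X: a finite trivialising open cover together with a
   cocycle of transition matrices g i j, taking coordinates (columns) in the
   j-th chart to coordinates in the i-th one.  The two cocycle conditions make
   the transition matrices invertible on the overlaps. *)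
Record vbundle := VBundle {
  rk : nat;
  idx : finType;
  chart : idx -> pspace k N -> Prop;
  trans : idx -> idx -> pspace k N -> 'M[k]_rk;
  chart_open : forall i, open_in X (chart i);
  chart_cover : forall x, X x -> exists i, chart i x;
  trans_regular : forall i j (a b : 'I_rk),
    regular X (fun x => chart i x /\ chart j x) (fun x => trans i j x a b);
  trans_id : forall i x, chart i x -> trans i i x = 1%:M;
  trans_cocycle : forall i j l x, chart i x -> chart j x -> chart l x ->
    trans i j x *m trans j l x = trans i l x }.

Definition bundle_map (V W : vbundle) : Type :=
  idx W -> idx V -> pspace k N -> 'M[k]_(rk W, rk V).

(* u b j is the matrix of the map from the j-th chart of V to the b-th chart of
   W; only its values on the overlap of the two charts matter. *)
Definition is_bundle_map (V W : vbundle) (u : bundle_map V W) : Prop :=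
  (forall b j s t, regular X (fun x => chart b x /\ chart j x)
                             (fun x => u b j x s t)) /\
  (forall a b i j x, chart a x -> chart b x -> chart i x -> chart j x ->
     trans a b x *m u b j x = u a i x *m trans i j x).

Definition bundle_iso (V W : vbundle) : Prop :=
  exists (u : bundle_map V W) (v : bundle_map W V),
    [/\ is_bundle_map u, is_bundle_map v,
        forall a i x, chart a x -> chart i x -> u a i x *m v i a x = 1%:M &
        forall a i x, chart a x -> chart i x -> v i a x *m u a i x = 1%:M].

Program Definition trivial_bundle (r : nat) : vbundle :=
  {| rk := r; idx := unit; chart := fun _ => X; trans := fun _ _ _ => 1%:M |}.
Next Obligation. by move=> r i; apply: open_in_full. Qed.
Next Obligation. by move=> r x Xx; exists tt. Qed.
Next Obligation. by move=> r i j a b; apply: regular_const => x []. Qed.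
Next Obligation. by []. Qed.
Next Obligation. by move=> r *; rewrite mulmx1. Qed.

Definition is_trivial (V : vbundle) : Prop :=
  exists r : nat, bundle_iso V (trivial_bundle r).

Program Definition tensor_bundle (V W : vbundle) : vbundle :=
  {| rk := (rk V * rk W)%N;
     idx := (idx V * idx W)%type;
     chart := fun i x => chart i.1 x /\ chart i.2 x;
     trans := fun i j x => trans i.1 j.1 x *t trans i.2 j.2 x |}.
Next Obligation. by move=> V W [i a] /=; apply: open_inI; apply: chart_open. Qed.
Next Obligation.
move=> V W x Xx; have [i ci] := chart_cover V Xx.
by have [a ca] := chart_cover W Xx; exists (i, a).
Qed.
Next Obligation.
move=> V W [i a] [j b] /= s t.
pose U x := (chart i x /\ chart a x) /\ (chart j x /\ chart b x).
have r1 s1 t1 : regular X U (fun x => trans i j x s1 t1).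
  by refine (regular_sub _ (@trans_regular _ i j s1 t1)) => x [[? ?] [? ?]].
have r2 s2 t2 : regular X U (fun x => trans a b x s2 t2).
  by refine (regular_sub _ (@trans_regular _ a b s2 t2)) => x [[? ?] [? ?]].
case: (mxtens_indexP s) => s1 s2; case: (mxtens_indexP t) => t1 t2.
move=> x Ux.
have [O [d [e [f [oO Ox he hf H]]]]] := regularM (r1 s1 t1) (r2 s2 t2) Ux.
by exists O, d, e, f; split=> // y Oy Uy; rewrite tensmxE; apply: H.
Qed.
Next Obligation.
move=> V W [i a] x [/= ci ca]; rewrite (trans_id ci) (trans_id ca).
apply/matrixP => s t; case: (mxtens_indexP s) => s1 s2.
case: (mxtens_indexP t) => t1 t2.
rewrite tensmxE !mxE (can_eq (@mxtens_indexK _ _)) xpair_eqE.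
by case: (s1 == t1); case: (s2 == t2); rewrite ?mulr1 ?mulr0 ?mul0r.
Qed.
Next Obligation.
move=> V W [i a] [j b] [l c] x /= [? ?] [? ?] [? ?].
by rewrite tensmx_mul !trans_cocycle.
Qed.

Section Frobenius.
Variables (p : nat) (hp : p \in [pchar k]).

(* The absolute Frobenius is the identity on points and f |-> f ^+ p on O_X, so
   pulling back along it raises the entries of the transition matrices to the
   p-th power. *)
Program Definition frob_pullback (V : vbundle) : vbundle :=
  {| rk := rk V; idx := idx V; chart := @chart V;
     trans := fun i j x => map_mx (fun c => c ^+ p) (trans i j x) |}.
Next Obligation. by move=> V; apply: chart_open. Qed.
Next Obligation. by move=> V; apply: chart_cover. Qed.
Next Obligation.
move=> V i j a b.
have sub x : chart i x /\ chart j x -> X x.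
  by case=> ci _; apply: open_in_sub (chart_open i) ci.
move=> x Ux; have [O [d [e [f [oO Ox he hf H]]]]] :=
  regularX p sub (@trans_regular _ i j a b) Ux.
by exists O, d, e, f; split=> // y Oy Uy; rewrite mxE; apply: H.
Qed.
Next Obligation.
move=> V i x ci /=; rewrite (trans_id ci).
by rewrite (map_mx1 (pFrobenius_aut hp)).
Qed.
Next Obligation.
move=> V i j l x ci cj cl /=; rewrite -(trans_cocycle ci cj cl).
by rewrite (map_mxM (pFrobenius_aut hp)).
Qed.

Definition F_trivial (V : vbundle) : Prop :=
  exists2 m : nat, (1 <= m)%N & is_trivial (iter m frob_pullback V).

(* pi^loc(X, x) is the functor sending a commutative k-algebra R to the group
   of tensor automorphisms of the R-linear fibre functor V |-> V_x (x)_k R on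
   the F-trivial bundles.  A linear endomorphism of V_x (x) R is given by its
   matrices in the charts around x. *)
Definition fibre_family (R : comAlgType k) : Type :=
  forall V : vbundle, idx V -> 'M[R]_(rk V).

Definition fibre_mx (R : comAlgType k) (m n : nat) (A : 'M[k]_(m, n)) :
  'M[R]_(m, n) := map_mx (in_alg R) A.

Definition pi_loc (x : pspace k N) (R : comAlgType k) (eta : fibre_family R) :
    Prop :=
  [/\ forall V, F_trivial V -> forall i, chart i x ->
        exists B, eta V i *m B = 1%:M /\ B *m eta V i = 1%:M,
      forall V, F_trivial V -> forall i j, chart i x -> chart j x ->
        eta V i *m fibre_mx R (trans i j x) =
        fibre_mx R (trans i j x) *m eta V j,
      forall V W, F_trivial V -> F_trivial W ->
        forall u : bundle_map V W, is_bundle_map u ->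
        forall a i, chart a x -> chart i x ->
        eta W a *m fibre_mx R (u a i x) = fibre_mx R (u a i x) *m eta V i,
      forall V W, F_trivial V -> F_trivial W ->
        forall i a, chart i x -> chart a x ->
        eta (tensor_bundle V W) (i, a) = eta V i *t eta W a &
      eta (trivial_bundle 1) tt = 1%:M].

Definition pi_loc_trivial (x : pspace k N) : Prop :=
  forall (R : comAlgType k) (eta : fibre_family R), pi_loc x eta ->
  forall V, F_trivial V -> forall i, chart i x -> eta V i = 1%:M.

End Frobenius.
End VectorBundles.

(* Main.v *)
Require Import Defs.
From mathcomp Require Import all_boot all_order all_algebra all_field.
From mathcomp Require Import zify ring.
From Stdlib Require Import Classical.

(** The heart of the matter is that a vector bundle [V] on [X] whose first
Frobenius pullback is trivial is itself trivial; the case of [m] Frobenius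
pullbacks follows by peeling them off one at a time.

A trivialisation of [F^* V] is a family of invertible matrices [u_i] on the
charts of [V] with [u_j = u_i g_ij^(p)], where [g_ij] are the transition
matrices of [V] and the exponent raises the entries to the [p]-th power.  If
every entry of every [u_i] is the [p]-th power of a regular function, then the
matrices of [p]-th roots trivialise [V], because Frobenius is injective.

The entries become [p]-th powers after pulling back to projective space.  Any
derivation kills [p]-th powers, so [du_j = du_i g_ij^(p)] and the matrices of
differentials [du_i u_i^-1] agree on overlaps: they form one global matrix of
differentials on the locus where the parametrisation [phi : P^n --> X] is
defined.  Instead of extending it over a set of codimension two, restrict to
the lines of [P^n] parallel to a coordinate axis.  After removing a common
factor from its coordinates, the composite of such a line with [phi] is a
morphism from the whole of [P^1] to [X], and [P^1] has no nonzero global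
differential: one would be [A dt] with [A] in [k(t)], regular at each point of
the affine line and vanishing at infinity ([frame_deriv0]).  So all partial
derivatives of the entries of [u_i o phi] are zero ([wronskian_pullback]).  As
[k] is perfect, these entries are [p]-th powers in [k(P^n)]
([mpoly_pth_root]).

Separability brings this down to [X]: an element of [k(X)] that becomes a
[p]-th power in a separable extension is a [p]-th power already
([separable_ext_pth_root], [pullback_pth_power]).  Normality finally makes the
roots regular, each being integral over the local rings of [X]
([pth_root_regular]).  Together these give [frobenius_descent].

For the group scheme, a tensor automorphism is the identity on the unit
object, hence on each trivial bundle by naturality along the coordinate
inclusions, hence on everything isomorphic to a trivial bundle. *)

Set Implicit Arguments.
Unset Strict Implicit.
Unset Printing Implicit Defensive.

Import GRing.Theory.
Local Open Scope ring_scope.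

Local Notation "x %:F" := (tofrac x).

(** * Frobenius and derivations on fraction fields *)

Section PowerOfPrime.
Variables (p : nat) (R : idomainType) (hp : p \in [pchar R]).

Lemma pcharXn_inj (x y : R) : x ^+ p = y ^+ p -> x = y.
Proof.
rewrite -!(pFrobenius_autE hp) => /eqP; rewrite -subr_eq0 -rmorphB /=.
rewrite pFrobenius_autE expf_eq0 (prime_gt0 (pcharf_prime hp)) subr_eq0.
by move/eqP.
Qed.

Lemma pcharX_sum (I : Type) (r : seq I) (P : pred I) (F : I -> R) :
  (\sum_(i <- r | P i) F i) ^+ p = \sum_(i <- r | P i) F i ^+ p.
Proof.
by rewrite -(pFrobenius_autE hp) rmorph_sum; apply: eq_bigr => i _;
   rewrite -(pFrobenius_autE hp).
Qed.

End PowerOfPrime.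

Section FractionDerivation.
Variables (R : idomainType) (d : R -> R).
Hypotheses (dD : {morph d : a b / a + b})
           (dM : forall a b, d (a * b) = d a * b + a * d b).

Lemma fraction_repr (x : {fraction R}) :
  x = (\n_(repr x))%:F / (\d_(repr x))%:F.
Proof.
have h := denom_ratioP (repr x); rewrite -[LHS]reprK.
apply/(canRL (mulfK _)); first by rewrite tofrac_eq0.
rewrite /GRing.mul /=; unlock tofrac; rewrite -FracField.pi_mul.
apply/eqmodP => /=; rewrite FracField.equivfE /FracField.mulf /=.
by rewrite !numden_Ratio ?oner_neq0 ?mulr1 ?mul1r //= mulrC.
Qed.

Lemma fraction_ratio (x : {fraction R}) :
  exists a b : R, b != 0 /\ x = a%:F / b%:F.
Proof.
by exists \n_(repr x), \d_(repr x); split; [apply: denom_ratioP|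
  apply: fraction_repr].
Qed.

Lemma fraction_eq (a b c e : R) : b != 0 -> e != 0 ->
  (a%:F / b%:F == c%:F / e%:F) = (a * e == c * b).
Proof.
by move=> b0 e0; rewrite eqr_div ?tofrac_eq0 // -!tofracM tofrac_eq.
Qed.

(** The quotient rule, applied to a chosen numerator and denominator;
[frac_derivE] shows that the choice is immaterial. *)
Definition frac_deriv (x : {fraction R}) : {fraction R} :=
  let r := repr x in
  (d \n_r * \d_r - \n_r * d \d_r)%:F / (\d_r ^+ 2)%:F.

Lemma frac_derivE (a b : R) : b != 0 ->
  frac_deriv (a%:F / b%:F) = (d a * b - a * d b)%:F / (b ^+ 2)%:F.
Proof.
move=> b0; set x := _ / _; rewrite /frac_deriv; set r := repr x.
have h := denom_ratioP r.
have /eqP : a * \d_r = \n_r * b.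
  apply/eqP; rewrite -fraction_eq //; apply/eqP; rewrite -/x.
  exact: fraction_repr.
move: \n_r \d_r h => n e e0 /eqP E; apply/eqP.
rewrite fraction_eq ?expf_neq0 //; apply/eqP.
have E' : d a * e + a * d e = d n * b + n * d b by rewrite -!dM E.
have -> : (d n * e - n * d e) * b ^+ 2 =
    (d n * b) * (e * b) - (n * b) * d e * b by ring.
have -> : d n * b = d a * e + a * d e - n * d b by rewrite E' addrK.
rewrite -E.
have -> : (d a * e + a * d e - n * d b) * (e * b) =
  (d a * e + a * d e) * (e * b) - (n * b) * d b * e by ring.
by rewrite -E; ring.
Qed.

Lemma frac_derivD : {morph frac_deriv : x y / x + y}.
Proof.
move=> x y; have [a [b [b0 ->]]] := fraction_ratio x.
have [c [e [e0 ->]]] := fraction_ratio y.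
rewrite addf_div ?tofrac_eq0 // -!tofracM -tofracD !frac_derivE ?mulf_neq0 //.
rewrite addf_div ?tofrac_eq0 ?expf_neq0 // -!tofracM -tofracD.
apply/eqP; rewrite fraction_eq ?mulf_neq0 ?expf_neq0 //; apply/eqP.
by rewrite dD !dM; ring.
Qed.

Lemma frac_derivM x y :
  frac_deriv (x * y) = frac_deriv x * y + x * frac_deriv y.
Proof.
have [a [b [b0 ->]]] := fraction_ratio x.
have [c [e [e0 ->]]] := fraction_ratio y.
rewrite mulf_div -!tofracM !frac_derivE ?mulf_neq0 // !mulf_div.
rewrite addf_div -!tofracM -?tofracD ?tofrac_eq0 ?mulf_neq0 ?expf_neq0 //.
apply/eqP; rewrite fraction_eq ?mulf_neq0 ?expf_neq0 //; apply/eqP.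
by rewrite !dM; ring.
Qed.

Lemma frac_deriv0 : frac_deriv 0 = 0.
Proof. by apply: (addrI (frac_deriv 0)); rewrite -frac_derivD !addr0. Qed.

Lemma frac_deriv1 : frac_deriv 1 = 0.
Proof.
apply: (addrI (frac_deriv 1)).
by rewrite addr0 -[RHS](congr1 frac_deriv (mulr1 1)) frac_derivM mulr1 mul1r.
Qed.

Lemma frac_deriv_sum (I : Type) (r : seq I) (P : pred I) F :
  frac_deriv (\sum_(i <- r | P i) F i) = \sum_(i <- r | P i) frac_deriv (F i).
Proof. exact: (big_morph _ frac_derivD frac_deriv0). Qed.

Lemma frac_derivX x m :
  frac_deriv (x ^+ m) = x ^+ m.-1 * frac_deriv x *+ m.
Proof.
elim: m => [|m IH]; first by rewrite expr0 frac_deriv1 mulr0n.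
rewrite exprS frac_derivM IH mulrS; case: m {IH} => [|m] /=.
  by rewrite !mulr0n !expr0 mulr1 mul1r mulr0.
by rewrite mulrnAr mulrA -exprS [X in X + _]mulrC.
Qed.

(** So the transition matrices of a Frobenius pullback count as constants. *)
Lemma frac_derivXp p x : p \in [pchar {fraction R}] -> frac_deriv (x ^+ p) = 0.
Proof. by move=> hp; rewrite frac_derivX mulrn_pchar. Qed.

Lemma frac_deriv_mulmx m n l (A : 'M[{fraction R}]_(m, n))
    (B : 'M[{fraction R}]_(n, l)) :
  map_mx frac_deriv (A *m B) =
  map_mx frac_deriv A *m B + A *m map_mx frac_deriv B.
Proof.
apply/matrixP => i j; rewrite !mxE frac_deriv_sum -big_split.
by apply: eq_bigr => s _; rewrite !mxE frac_derivM.
Qed.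

Lemma frac_deriv_scalar m : map_mx frac_deriv (1%:M : 'M_m) = 0.
Proof.
apply/matrixP => i j; rewrite !mxE.
by case: eqP => _; rewrite /= ?mulr1n ?mulr0n ?frac_deriv0 ?frac_deriv1.
Qed.

End FractionDerivation.

(** * Descent of p-th powers along separable extensions *)

Section Subfields.
Variable M : fieldType.
Implicit Types E : M -> Prop.

Definition is_subfield E : Prop :=
  [/\ E 1, forall x y, E x -> E y -> E (x - y),
      forall x y, E x -> E y -> E (x * y) & forall x, E x -> E x^-1].

Section Closure.
Variables (E : M -> Prop) (hE : is_subfield E).

Lemma subfield1 : E 1. Proof. by case: hE. Qed.
Lemma subfieldB x y : E x -> E y -> E (x - y). Proof. by case: hE; auto. Qed.
Lemma subfieldM x y : E x -> E y -> E (x * y). Proof. by case: hE; auto. Qed.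
Lemma subfieldV x : E x -> E x^-1. Proof. by case: hE; auto. Qed.
Lemma subfield0 : E 0.
Proof. by rewrite -(subrr 1); apply: subfieldB; apply: subfield1. Qed.
Lemma subfieldN x : E x -> E (- x).
Proof. by rewrite -sub0r; apply: subfieldB; apply: subfield0. Qed.
Lemma subfieldD x y : E x -> E y -> E (x + y).
Proof. by move=> Ex Ey; rewrite -(opprK y); apply/subfieldB/subfieldN. Qed.
Lemma subfield_sum (I : Type) (r : seq I) (P : pred I) F :
  (forall i, P i -> E (F i)) -> E (\sum_(i <- r | P i) F i).
Proof.
by move=> h; apply: big_ind => //; [apply: subfield0|apply: subfieldD].
Qed.
Definition poly_over (f : {poly M}) := forall i, E f`_i.

Lemma poly_overB f g : poly_over f -> poly_over g -> poly_over (f - g).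
Proof. by move=> hf hg i; rewrite coefB; apply: subfieldB. Qed.
Lemma poly_overM f g : poly_over f -> poly_over g -> poly_over (f * g).
Proof.
by move=> hf hg i; rewrite coefM; apply: subfield_sum => j _; apply: subfieldM.
Qed.
Lemma poly_overC c : E c -> poly_over c%:P.
Proof. by move=> Ec i; rewrite coefC; case: ifP => // _; apply: subfield0. Qed.
Lemma poly_overXn m : poly_over 'X^m.
Proof.
by move=> i; rewrite coefXn; case: eqP => _; [apply: subfield1|apply: subfield0].
Qed.

(** Euclidean division does not leave the field of coefficients: each step
subtracts a multiple whose leading coefficient is a quotient of coefficients. *)
Lemma poly_over_modp (c f : {poly M}) : c != 0 -> poly_over c -> poly_over f ->
  poly_over (f %% c).
Proof.
move=> c0 hc; have [n] := ubnP (size f); elim: n f => // n IH f lt_f hf.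
have [lt_fc|le_cf] := ltnP (size f) (size c); first by rewrite modp_small.
pose m := (size f - size c)%N; pose a := lead_coef f / lead_coef c.
have c1 : (0 < size c)%N by rewrite size_poly_gt0.
have -> : f %% c = (f - (a%:P * 'X^m) * c) %% c.
  by rewrite modpD -mulNr modp_mull addr0.
apply: IH; last first.
  apply: poly_overB => //; apply/poly_overM => //; apply: poly_overM.
    by apply/poly_overC/subfieldM; [apply: hf|apply/subfieldV/hc].
  exact: poly_overXn.
rewrite -ltnS; apply: leq_trans lt_f; rewrite ltnS.
have f1 := leq_trans c1 le_cf; rewrite -[ltnRHS](prednK f1) ltnS.
apply/leq_sizeP => j lt_j; rewrite coefB -mulrA mulrC -mulrA coefXnM coefMC.
have mf : (m <= j)%N.
  by rewrite /m; apply: leq_trans lt_j; rewrite -subn1 leq_sub2l.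
rewrite ltnNge mf /=; move: lt_j; rewrite leq_eqVlt => /orP[/eqP <-|lt_j].
  have -> : ((size f).-1 - m = (size c).-1)%N by rewrite /m; lia.
  by rewrite -!lead_coefE /a mulrC divfK ?subrr // lead_coef_eq0.
rewrite (nth_default 0 (_ : size f <= j)%N); last by rewrite -(prednK f1).
rewrite (nth_default 0 (_ : size c <= j - m)%N) ?mul0r ?subr0 //.
by move: lt_j; rewrite /m; lia.
Qed.

End Closure.
End Subfields.

Section SeparableDescent.
Variables (M : fieldType) (p : nat) (hp : p \in [pchar M]).
Implicit Types E : M -> Prop.

(** If [c] has least degree among the nonzero polynomials over [E] that vanish
at [y], then [c] divides both [X^p - y^p = (X - y)^p] and a separable
polynomial.  So [c] is a power of [X - y] with no square factor, which puts [y]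
in [E].  The induction on the degree replaces the choice of a minimal [c]. *)
Lemma separable_pth_root E y :
  is_subfield E -> separable_alg E y -> E (y ^+ p) -> E y.
Proof.
move=> hE [q [hq sq rq]] Eyp.
pose h : {poly M} := 'X^p - (y ^+ p)%:P.
have hX : h = ('X - y%:P) ^+ p.
  have hpP : p \in [pchar {poly M}] by rewrite pchar_poly.
  by rewrite /h -[RHS](pFrobenius_autE hpP) rmorphB /= !pFrobenius_autE polyC_exp.
have hh : poly_over E h.
  by apply: poly_overB => //; [apply: poly_overXn|apply: poly_overC].
suff H n (c : {poly M}) : (size c <= n)%N -> poly_over E c -> c != 0 ->
    root c y -> E y.
  by apply: (H (size q) q) => //; apply: separable_poly_neq0.
elim: n c => [|n IH] c; first by rewrite leqn0 size_poly_eq0 => ->.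
move=> sz hc c0 rc.
have rem f : poly_over E f -> root f y -> E y \/ c %| f.
  move=> hf rf; have [d|nd] := boolP (c %| f); first by right.
  left; apply: (IH (f %% c)) => //.
  - by rewrite -ltnS (leq_trans _ sz) // ltn_modp.
  - exact: poly_over_modp.
  move: rf; rewrite {1}(divp_eq f c) /root hornerD hornerM (rootP rc).
  by rewrite mulr0 add0r.
have rh : root h y.
  by rewrite hX /root horner_exp hornerXsubC subrr expr0n eqn0Ngt
             (prime_gt0 (pcharf_prime hp)).
case: (rem _ hh rh) => // ch; case: (rem _ hq rq) => // cq.
move: ch; rewrite hX => /dvdp_exp_XsubCP[m _ cm].
have sc := dvdp_separable cq sq.
case: m => [|[|m]] in cm.
- by move: rc; rewrite (eqp_root cm) expr0 /root hornerC oner_eq0.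
- move: cm; rewrite expr1 => cm; case/eqpf_eq: cm => a a0 ce.
  have := hc 1%N; have := hc 0%N; rewrite ce !coefZ !coefB !coefX !coefC /=.
  rewrite subr0 mulr1 sub0r mulrN => h0 ha.
  rewrite -(mulKf a0 y) -(opprK (a * y)).
  exact: subfieldM (subfieldV hE ha) (subfieldN hE h0).
- have := separable_nosquare (u := 'X - y%:P) (k := m.+2) sc isT.
  by rewrite size_XsubC (eqp_dvdr _ cm) dvdpp => /(_ isT).
Qed.

Lemma mpoly_overM E n (a b : {mpoly M[n]}) : is_subfield E ->
  (forall m, E a@_m) -> (forall m, E b@_m) -> forall m, E (a * b)@_m.
Proof.
move=> hE ha hb m; rewrite mcoeffM; apply: subfield_sum => // i _.
exact: subfieldM.
Qed.

Lemma mpoly_overX E n (a : {mpoly M[n]}) l : is_subfield E ->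
  (forall m, E a@_m) -> forall m, E (a ^+ l)@_m.
Proof.
move=> hE ha; elim: l => [|l IH] m.
  rewrite expr0 mcoeff1; case: eqP => _; [exact: subfield1|exact: subfield0].
by rewrite exprS; apply: mpoly_overM.
Qed.

Lemma adjoin_subfield E d (t : 'I_d -> M) : is_subfield E ->
  is_subfield (adjoin E t).
Proof.
move=> hE.
have h1 m : E (1 : {mpoly M[d]})@_m.
  by rewrite mcoeff1; case: eqP => _; [apply: subfield1|apply: subfield0].
split.
- by exists 1, 1; rewrite meval1 oner_neq0 divr1.
- move=> _ _ [a [b [ha hb b0 ->]]] [c [e [hc he e0 ->]]].
  exists (a * e - c * b), (b * e); split.
  + by move=> m; rewrite mcoeffB; apply: subfieldB => //; apply: mpoly_overM.
  + exact: mpoly_overM.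
  + by rewrite mevalM mulf_neq0.
  + by rewrite mevalB !mevalM -mulNr addf_div // mulNr.
- move=> _ _ [a [b [ha hb b0 ->]]] [c [e [hc he e0 ->]]].
  exists (a * c), (b * e); split; try exact: mpoly_overM.
    by rewrite mevalM mulf_neq0.
  by rewrite !mevalM mulf_div.
- move=> _ [a [b [ha hb b0 ->]]].
  have [a0|a0] := eqVneq a.@[t] 0.
    exists 0, 1; split=> //; first by move=> m; rewrite mcoeff0; apply: subfield0.
    by rewrite meval1 oner_neq0.
    by rewrite a0 mul0r invr0 meval0 mul0r.
  by exists b, a; split=> //; rewrite invf_div.
Qed.

Lemma sub_adjoin E d (t : 'I_d -> M) z : is_subfield E -> E z -> adjoin E t z.
Proof.
move=> hE Ez; exists z%:MP, 1; rewrite mevalC meval1 divr1 oner_neq0.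
split=> // m; rewrite ?mcoeffC ?mcoeff1; case: eqP => _;
  rewrite ?mulr1 ?mulr0 //; by [apply: subfield0|apply: subfield1].
Qed.

(** With [L] separable algebraic over [E(t)], the element [y] lies in [E(t)] by
[separable_pth_root], say [y = a(t) / b(t)].  By algebraic independence
[a^p = y^p b^p] holds for the polynomials themselves, so [a = y b], and
comparing one nonzero coefficient of [b] exhibits [y] as an element of [E]. *)
Lemma separable_ext_pth_root E L y : is_subfield E -> separable_ext E L ->
  L y -> E (y ^+ p) -> E y.
Proof.
move=> hE [d [t [_ ind sep]]] Ly Eyp.
have [a [b [ha hb bt0 ye]]] : adjoin E t y.
  apply: separable_pth_root (sep _ Ly) _; first exact: adjoin_subfield.
  exact: sub_adjoin.
have hpM : p \in [pchar {mpoly M[d]}].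
  by rewrite (rmorph_pchar (@mpolyC d M) hp).
have eqab : a ^+ p - y ^+ p *: b ^+ p = 0.
  apply: ind => [m|].
    rewrite mcoeffB mcoeffZ; apply: subfieldB => //; first exact: mpoly_overX.
    by apply: subfieldM => //; apply: mpoly_overX.
  rewrite mevalB mevalZ !rmorphXn /= ye expr_div_n divfK ?subrr //.
  exact: expf_neq0.
have {eqab} eab : a = y *: b.
  apply: (pcharXn_inj hpM); rewrite exprZn; apply/eqP.
  by rewrite -subr_eq0 eqab.
have [m bm] : exists m, b@_m != 0.
  apply: NNPP => H; move: bt0; have -> : b = 0; last by rewrite meval0 eqxx.
  apply/mpolyP => m; rewrite mcoeff0; apply/eqP/negPn/negP => bm.
  by apply: H; exists m.
have -> : y = a@_m / b@_m by rewrite eab mcoeffZ mulfK.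
by apply: subfieldM => //; apply: subfieldV.
Qed.

End SeparableDescent.

(** * Homogeneous polynomials and p-th powers in several variables *)

Section Homogeneous.
Variables (R : comNzRingType) (n : nat).

Lemma mmap_homog_scale (S : comNzRingType) (f : {rmorphism R -> S})
    (h : 'I_n -> S) (c : S) d (a : {mpoly R[n]}) : a \is d.-homog ->
  mmap f (fun i => c * h i) a = c ^+ d * mmap f h a.
Proof.
move=> /dhomogP ha; rewrite /mmap mulr_sumr !big_seq.
apply: eq_bigr => m /ha dm.
rewrite mulrCA; congr (_ * _); rewrite /mmap1.
under eq_bigr do rewrite exprMn.
have -> : d = (\sum_(i < n) m i)%N by rewrite -mdegE dm.
by rewrite big_split prodrXr.
Qed.

Lemma meval_homog_scale (h : 'I_n -> R) (c : R) d (a : {mpoly R[n]}) :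
  a \is d.-homog -> a.@[fun i => c * h i] = c ^+ d * a.@[h].
Proof. exact: (mmap_homog_scale idfun). Qed.

Lemma comp_mpoly_homog N (phi : n.-tuple {mpoly R[N]}) d e (a : {mpoly R[n]}) :
  (forall i, tnth phi i \is d.-homog) -> a \is e.-homog ->
  a \mPo phi \is (d * e)%N.-homog.
Proof.
move=> hphi /dhomogP ha; rewrite comp_mpolyE big_seq.
apply: rpred_sum => m /ha dm; apply: rpredZ.
have -> : (d * e = \sum_(i < n) d * m i)%N by rewrite -big_distrr -mdegE -dm.
elim/big_rec2: _ => [|i x y _ hy]; first exact: dhomog1.
by apply: dhomogM => //; apply: dhomogMn.
Qed.

End Homogeneous.

Section LineRestriction.
Variables (R : comNzRingType) (n : nat).

Lemma horner_mmap (h : 'I_n -> {poly R}) (a : {mpoly R[n]}) t :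
  (mmap (@polyC R) h a).[t] = a.@[fun i => (h i).[t]].
Proof.
rewrite /mmap mevalE -horner_evalE rmorph_sum; apply: eq_bigr => m _.
rewrite rmorphM rmorph_prod /= horner_evalE hornerC; congr (_ * _).
by apply: eq_bigr => i _; rewrite rmorphXn.
Qed.

Lemma mmap_comp_mpoly N (phi : N.-tuple {mpoly R[n]}) (h : 'I_n -> {poly R})
    (a : {mpoly R[N]}) :
  mmap (@polyC R) h (a \mPo phi) =
  mmap (@polyC R) (fun i => mmap (@polyC R) h (tnth phi i)) a.
Proof.
rewrite comp_mpolyE [LHS]raddf_sum [RHS]/mmap; apply: eq_bigr => m _ /=.
rewrite mmapZ rmorph_prod; congr (_ * _).
by apply: eq_bigr => i _; rewrite rmorphXn.
Qed.

Definition coord_line (w : 'I_n -> R) (l i : 'I_n) : {poly R} :=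
  (w i)%:P + (i == l)%:R *: 'X.

(** The chain rule for the restriction of [a] to a coordinate line. *)
Lemma deriv_coord_line w l (a : {mpoly R[n]}) :
  (mmap (@polyC R) (coord_line w l) a)^`() =
  mmap (@polyC R) (coord_line w l) a^`M(l).
Proof.
set L := mmap _ _.
have LM : {morph L : x y / x * y} by apply: rmorphM.
have LD : {morph L : x y / x + y} by apply: raddfD.
have LC c : L c%:MP = c%:P by apply: mmapC.
have L0 : L 0 = 0 by apply: raddf0.
have LU i : L 'X_i = coord_line w l i by rewrite /L mmapX mmap1U.
have LZ c b : L (c *: b) = c%:P * L b by apply: mmapZ.
clearbody L.
suff H m : (L 'X_[m])^`() = L 'X_[m]^`M(l).
  elim/mpolyind: a => [|c m a _ _ IH]; first by rewrite mderiv0 L0 derivC.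
  rewrite mderivD mderivZ !LD !LZ derivD derivM derivC.
  by rewrite mul0r add0r H IH.
rewrite mpolyXE_id.
have L1 : (L 1)^`() = L 1^`M(l) by rewrite -mpolyC1 mderivC LC L0 derivC.
elim: (index_enum _) => [|i s IH]; first by rewrite big_nil.
rewrite !big_cons LM derivM mderivM LD !LM IH; congr (_ * _ + _).
elim: (m i) => [|e IHe] //.
rewrite !exprS LM derivM mderivM LD !LM IHe; congr (_ * _ + _).
rewrite LU /coord_line derivD derivC add0r derivZ derivX mderivX LZ mnm1E.
case: eqP => [->|_]; last by rewrite scale0r mul0r.
have -> : (U_(l) - U_(l) = 0 :> 'X_{1..n})%MM.
  by apply/mnmP => j; rewrite mnmBE mnm0E subnn.
by rewrite mpolyX0 -mpolyC1 LC -mul_polyC mulr1.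
Qed.

End LineRestriction.

Section ClosedField.
Variable k : closedFieldType.

(** Induction on the number of variables: expand [a] in powers of the last
variable, choose a point where one coefficient survives, then a value of the
last variable. *)
Lemma mpoly_nonroot n (a : {mpoly k[n]}) : a != 0 -> exists v, a.@[v] != 0.
Proof.
elim: n a => [|n IH] a a0.
  exists (fun=> 0); apply: contra a0 => /eqP ea; apply/eqP/mpolyP => m.
  have m0 (m' : 'X_{1..0}) : m' = 0%MM by apply/mnmP => -[].
  have am : a@_m = 0; last by rewrite am mcoeff0.
  apply/eqP/negPn/negP => am; have ms : m \in msupp a by rewrite mcoeff_msupp.
  case/eqP: am; rewrite -ea mevalE (big_rem m) //= [X in _ + X]big1_seq.
    by rewrite big_ord0 mulr1 addr0.
  by move=> m1 /=; rewrite (m0 m1) (m0 m) mem_rem_uniqF ?msupp_uniq.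
have [m am] : exists m, a@_m != 0.
  have : mlead a \in msupp a by apply: mlead_supp.
  by rewrite mcoeff_msupp; exists (mlead a).
pose r (m : 'X_{1..n.+1}) := [multinom (m (widen_ord (leqnSn n) i)) | i < n].
have mcE : ((muni a)`_(m ord_max))@_(r m) = a@_m.
  rewrite muniE coef_sum raddf_sum /= (big_rem m) /= ?mcoeff_msupp //.
  rewrite [X in _ + X]big1_seq.
    rewrite addr0 coefZ coefXn eqxx mulr1 mcoeffZ mcoeffX.
    by rewrite eqxx mulr1.
  move=> m1 /=; rewrite mem_rem_uniq ?msupp_uniq // inE => /andP[ne _].
  rewrite coefZ coefXn; case: eqP => [e1|]; last by rewrite mulr0 mcoeff0.
  rewrite mulr1 mcoeffZ mcoeffX; case: eqP => [e2|]; last by rewrite mulr0.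
  case/eqP: ne; apply/mnmP => i; case: (unliftP ord_max i) => [j|] -> //.
  have := congr1 (fun f : 'X_{1..n} => f j) e2; rewrite !mnmE.
  have -> // : widen_ord (leqnSn n) j = lift ord_max j.
  by apply/ord_inj; rewrite lift_max.
have /IH[v nv] : (muni a)`_(m ord_max) != 0.
  by apply: contraNneq am => e; rewrite -mcE e mcoeff0.
have : map_poly (meval v) (muni a) != 0.
  apply: contraNneq nv => e.
  have := congr1 (fun q : {poly k} => q`_(m ord_max)) e.
  by rewrite coef_map coef0 /= => ->.
case/closed_nonrootP => t; rewrite /root => nt.
pose w i := if unlift ord_max i is Some j then v j else t.
exists w; suff <- : (map_poly (meval v) (muni a)).[t] = a.@[w] by [].
rewrite muniE mevalE -horner_evalE !rmorph_sum /=; apply: eq_bigr => m1 _.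
rewrite -!mul_polyC !rmorphM /= map_polyXn !map_polyC /=.
rewrite /horner_eval hornerC hornerXn mevalZ mevalX -mulrA; congr (_ * _).
rewrite big_ord_recr /= /w unlift_none; congr (_ * _); apply: eq_bigr => i _.
have -> : widen_ord (leqnSn n) i = lift ord_max i.
  by apply/ord_inj; rewrite lift_max.
rewrite liftK mnmE; congr (_ ^+ m1 _).
by apply/ord_inj; rewrite lift_max.
Qed.

Lemma mpoly_eq0_eval n (a : {mpoly k[n]}) : (forall v, a.@[v] = 0) -> a = 0.
Proof.
move=> h; apply/eqP/negPn/negP => /mpoly_nonroot[v].
by rewrite h eqxx.
Qed.

Lemma poly_nonroot (f : {poly k}) : f != 0 -> exists t, f.[t] != 0.
Proof. by case/closed_nonrootP => t; exists t. Qed.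

Variables (p : nat) (hp : p \in [pchar k]).

Lemma pth_root_exists (x : k) : exists y, y ^+ p == x.
Proof.
have p0 := prime_gt0 (pcharf_prime hp).
have [y /rootP] : exists y, root ('X^p - x%:P) y.
  by apply/closed_rootP; rewrite size_XnsubC // eqSS -lt0n.
rewrite hornerD hornerN hornerXn hornerC => /eqP.
by rewrite subr_eq0; exists y.
Qed.

Definition pth_root (x : k) : k := xchoose (pth_root_exists x).

Lemma pth_rootK x : pth_root x ^+ p = x.
Proof. exact/eqP/(xchooseP (pth_root_exists x)). Qed.

(** Vanishing derivatives leave only monomials all of whose exponents are
divisible by [p]; dividing these exponents by [p] and taking roots of the
coefficients gives the root. *)
Lemma mpoly_pth_root n d (f : {mpoly k[n]}) :
  f \is (p * d)%N.-homog -> (forall i, f^`M(i) = 0) ->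
  exists2 g : {mpoly k[n]}, g \is d.-homog & f = g ^+ p.
Proof.
move=> /dhomogP hf df; have p0 := prime_gt0 (pcharf_prime hp).
have dvd_m (m : 'X_{1..n}) i : m \in msupp f -> (p %| m i)%N.
  rewrite mcoeff_msupp => fm; have [//|nd] := boolP (p %| m i)%N.
  have mi0 : m i != 0%N by apply: contraNneq nd => ->; rewrite dvdn0.
  (* The derivative has m i times the coefficient of f there. *)
  have := congr1 (fun g => g@_(m - U_(i))%MM) (df i).
  rewrite mcoeff_mderiv mcoeff0 submK ?mnmBE ?mnm1E ?eqxx; last first.
    apply/mnm_lepP => j; rewrite mnm1E; case: eqP => [<-|] //=.
    by rewrite lt0n.
  rewrite subn1 prednK ?lt0n // -mulr_natl => /eqP.
  by rewrite mulf_eq0 (negPf fm) orbF -(dvdn_pcharf hp) (negPf nd).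
pose q (m : 'X_{1..n}) := [multinom (m i %/ p)%N | i < n].
have qK m : m \in msupp f -> (q m *+ p)%MM = m.
  by move=> mf; apply/mnmP => i; rewrite mulmnE mnmE divnK ?dvd_m.
exists (\sum_(m <- msupp f) pth_root f@_m *: 'X_[q m]).
  rewrite big_seq; apply: rpred_sum => m mf; apply: rpredZ.
  rewrite dhomogX /= -(eqn_pmul2l p0) -(hf m mf).
  by rewrite -[X in _ == mdeg X](qK m mf) mdegMn mulnC.
have hpM : p \in [pchar {mpoly k[n]}].
  exact: (rmorph_pchar (@mpolyC n k) hp).
rewrite (pcharX_sum hpM) [LHS]mpolyE !big_seq; apply: eq_bigr => m mf.
by rewrite exprZn pth_rootK mpolyXn qK.
Qed.

End ClosedField.

(** * Points and dense open subsets of projective varieties *)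

Section Points.
Variables (k : closedFieldType) (N : nat).
Implicit Types (v : 'I_N.+1 -> k) (x : pspace k N).

(** The junk value at the zero vector makes [point] a total function, so that
curves can be written as functions of their parameter. *)
Definition point_vector v : 'rV[k]_N.+1 :=
  let u := \row_i v i in if u == 0 then const_mx 1 else u.

Lemma point_subproof v : \dim <[point_vector v]>%VS == 1%N.
Proof.
rewrite dim_vline /point_vector; case: ifP => [_|-> //].
rewrite eqb1; apply/eqP => /matrixP/(_ 0 0)/eqP.
by rewrite !mxE oner_eq0.
Qed.

Definition point v : pspace k N :=
  exist _ <[point_vector v]>%VS (point_subproof v).

Lemma point_val v : (exists i, v i != 0) -> val (point v) = <[\row_i v i]>%VS.
Proof.
case=> i vi; rewrite /= /point_vector; case: eqP => // /matrixP/(_ 0 i)/eqP.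
by rewrite !mxE (negPf vi).
Qed.

Lemma hcoord_neq0 x : exists i, hcoord x 0 i != 0.
Proof.
have [i hi|h] := pickP (fun i => hcoord x 0 i != 0); first by exists i.
have /eqP := valP x; have : hcoord x = 0.
  by apply/rowP => i; rewrite mxE; apply/eqP; rewrite -[_ == _]negbK h.
by move/eqP; rewrite /hcoord vpick0 => /eqP ->; rewrite dimv0.
Qed.

Lemma hcoord_scale x v : val x = <[\row_i v i]>%VS ->
  exists2 c, c != 0 & forall i, hcoord x 0 i = c * v i.
Proof.
move=> xv; have : hcoord x \in <[\row_i v i]>%VS by rewrite -xv memv_pick.
case/vlineP => c e; have [i hi] := hcoord_neq0 x.
exists c => [|j]; last by rewrite e !mxE.
by apply: contraNneq hi => c0; rewrite e c0 scale0r mxE.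
Qed.

Lemma peval_scale x v : val x = <[\row_i v i]>%VS ->
  exists2 c, c != 0 & forall d (f : {mpoly k[N.+1]}), f \is d.-homog ->
    peval f x = c ^+ d * f.@[v].
Proof.
case/hcoord_scale => c c0 e; exists c => // d f hf.
by rewrite -(meval_homog_scale _ _ hf); apply: meval_eq.
Qed.

Lemma peval_eq0 x v d (f : {mpoly k[N.+1]}) : val x = <[\row_i v i]>%VS ->
  f \is d.-homog -> (peval f x == 0) = (f.@[v] == 0).
Proof.
case/peval_scale => c c0 e /e ->.
by rewrite mulf_eq0 expf_eq0 (negPf c0) andbF.
Qed.

Lemma peval_ratio x v d (a b : {mpoly k[N.+1]}) : val x = <[\row_i v i]>%VS ->
  a \is d.-homog -> b \is d.-homog -> peval a x / peval b x = a.@[v] / b.@[v].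
Proof.
case/peval_scale => c c0 e /e -> /e ->.
by rewrite -mulf_div divff ?mul1r // expf_neq0.
Qed.

Lemma point_eq v x : val x = <[\row_i v i]>%VS -> x = point v.
Proof.
move=> xv; apply/val_inj; rewrite xv point_val //.
have [i] := hcoord_neq0 x; have [c _ ->] := hcoord_scale xv.
by rewrite mulf_eq0 negb_or => /andP[_]; exists i.
Qed.

Lemma closed_zeros d (h : {mpoly k[N.+1]}) : h \is d.-homog ->
  is_closed (fun x => peval h x = 0).
Proof.
move=> hh; exists (fun f => f = h); split=> [f ->|x]; first by exists d.
by split=> [e f ->|] //; apply.
Qed.

Variable X : variety k N.

Lemma open_nonzeros d (h : {mpoly k[N.+1]}) : h \is d.-homog ->
  open_in X (fun x => X x /\ peval h x != 0).
Proof.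
move=> hh; exists (fun x => peval h x = 0); first exact: closed_zeros hh.
by move=> x; split=> -[Xx /eqP].
Qed.

Lemma open_meet U W : open_in X U -> open_in X W -> (exists x, U x) ->
  (exists x, W x) -> exists x, U x /\ W x.
Proof.
move=> [Z cZ UE] [T cT WE] [x /UE[Xx nZ]] [y /WE[Xy nT]].
apply: NNPP => H; case: (pts_irreducible X) => _ /(_ Z T cZ cT) [].
- move=> z Xz; apply: NNPP => nz; apply: H; exists z; rewrite UE WE.
  by split; split=> // h; apply: nz; [left|right].
- by move/(_ x Xx).
- by move/(_ y Xy).
Qed.

Lemma zero_dense U d (h : {mpoly k[N.+1]}) : open_in X U -> (exists x, U x) ->
  h \is d.-homog -> (forall x, U x -> peval h x = 0) ->
  forall x, X x -> peval h x = 0.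
Proof.
move=> oU neU hh hU x Xx; apply/eqP/negPn/negP => nz.
have [//||y [Uy [Xy /eqP]]] := open_meet oU (open_nonzeros hh).
  by exists x.
by case; apply: hU.
Qed.

(** The identity principle: locally the difference of [f] and [g] has a
homogeneous numerator, which vanishes on a nonempty open set and hence on [X]. *)
Lemma regular_eq_dense O U f g : open_in X O -> open_in X U ->
  (exists x, O x /\ U x) -> regular X O f -> regular X O g ->
  (forall x, O x -> U x -> f x = g x) -> forall x, O x -> f x = g x.
Proof.
move=> oO oU neU rf rg fg x Ox.
have Xx : X x := open_in_sub oO Ox.
have [V [d [a [b [oV Vx ha hb ab]]]]] := rf x Ox.
have [W [e [a' [b' [oW Wx ha' hb' ab']]]]] := rg x Ox.
have oOVW := open_inI oO (open_inI oV oW).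
have [||y0 neq] := open_meet (open_inI oO oU) oOVW; [by []|by exists x|].
have z : forall y, X y -> peval (a * b' - a' * b) y = 0.
  apply: (zero_dense (open_inI (open_inI oO oU) oOVW) (d := (d + e)%N)).
  - by exists y0.
  - by apply: rpredB; [|rewrite addnC]; apply: dhomogM.
  move=> y [[Oy Uy] [_ [Vy Wy]]].
  have [b0 fy] := ab y Vy Oy; have [b'0 gy] := ab' y Wy Oy.
  rewrite /peval mevalB !mevalM; apply/eqP; rewrite subr_eq0.
  rewrite -eqr_div //; apply/eqP.
  by rewrite -[LHS]fy -[RHS]gy fg.
have [b0 ->] := ab x Vx Ox; have [b'0 ->] := ab' x Wx Ox.
apply/eqP; rewrite eqr_div // -subr_eq0.
by have := z x Xx; rewrite /peval mevalB !mevalM => ->.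
Qed.

End Points.

(** * Rational functions of one variable *)

Section Germs.
Variable k : closedFieldType.
Implicit Types (P Q : k -> Prop) (F G : {fraction {poly k}}).

(** For all but finitely many [t], phrased with a polynomial that excludes the
exceptions, so that conjunctions correspond to products. *)
Definition generically P : Prop :=
  exists2 f : {poly k}, f != 0 & forall t, f.[t] != 0 -> P t.

Lemma generically_and P Q :
  generically P -> generically Q -> generically (fun t => P t /\ Q t).
Proof.
move=> [f f0 hf] [g g0 hg]; exists (f * g) => [|t]; first exact: mulf_neq0.
by rewrite hornerM mulf_eq0 negb_or => /andP[/hf ? /hg ?].
Qed.

Lemma generically_sub P Q :
  (forall t, P t -> Q t) -> generically P -> generically Q.
Proof. by move=> PQ [f f0 hf]; exists f => // t /hf/PQ. Qed.

Lemma generically_exists P : generically P -> exists t, P t.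
Proof. by case=> f /poly_nonroot[t ft] hf; exists t; apply: hf. Qed.

Lemma poly_eq0_generically (f : {poly k}) :
  generically (fun t => f.[t] = 0) -> f = 0.
Proof.
case=> g g0 h; have /eqP : f * g = 0; last first.
  by rewrite mulf_eq0 (negPf g0) orbF => /eqP.
apply: NNPP => /eqP/poly_nonroot[t]; rewrite hornerM.
have [-> |/h ->] := eqVneq g.[t] 0; by rewrite ?mulr0 ?mul0r eqxx.
Qed.

Definition germ (f : k -> k) F : Prop :=
  exists a b : {poly k}, [/\ b != 0, F = a%:F / b%:F &
    generically (fun t => b.[t] != 0 /\ f t = a.[t] / b.[t])].

Lemma germ_uniq f g F G : generically (fun t => f t = g t) ->
  germ f F -> germ g G -> F = G.
Proof.
move=> fg [a [b [b0 -> h]]] [c [e [e0 -> h']]]; apply/eqP.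
rewrite fraction_eq // -subr_eq0; apply/eqP/poly_eq0_generically.
apply: generically_sub (generically_and fg (generically_and h h')).
move=> t [ft [[bt fE] [et gE]]].
move: ft; rewrite fE gE => /eqP; rewrite eqr_div // => /eqP E.
by rewrite hornerD hornerN !hornerM E subrr.
Qed.

Lemma germ_ratio (f : k -> k) (a b : {poly k}) : b != 0 ->
  generically (fun t => f t = a.[t] / b.[t]) -> germ f (a%:F / b%:F).
Proof.
move=> b0 h; exists a, b; split=> //; apply: generically_and h.
by exists b.
Qed.

Lemma germC c : germ (fun=> c) (c%:P)%:F.
Proof.
rewrite -[X in germ _ X]divr1 -tofrac1; apply: germ_ratio (oner_neq0 _) _.
by exists 1 => [|t _]; rewrite ?oner_neq0 // !hornerC divr1.
Qed.

Lemma germ0 : germ (fun=> 0) 0.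
Proof. by have := germC 0; rewrite polyC0 tofrac0. Qed.

Lemma germ1 : germ (fun=> 1) 1.
Proof. by have := germC 1; rewrite polyC1 tofrac1. Qed.

Lemma eq_germ f g F : germ f F -> f =1 g -> germ g F.
Proof.
move=> [a [b [b0 -> h]]] fg; exists a, b; split=> //.
by apply: generically_sub h => t; rewrite fg.
Qed.

Lemma germD f g F G : germ f F -> germ g G -> germ (fun t => f t + g t) (F + G).
Proof.
move=> [a [b [b0 -> h]]] [c [e [e0 -> h']]].
rewrite addf_div ?tofrac_eq0 // -!tofracM -tofracD.
apply: germ_ratio; first exact: mulf_neq0.
apply: generically_sub (generically_and h h') => t [[bt ->] [et ->]].
by rewrite addf_div // hornerD !hornerM.
Qed.

Lemma germM f g F G : germ f F -> germ g G -> germ (fun t => f t * g t) (F * G).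
Proof.
move=> [a [b [b0 -> h]]] [c [e [e0 -> h']]].
rewrite mulf_div -!tofracM; apply: germ_ratio; first exact: mulf_neq0.
apply: generically_sub (generically_and h h') => t [[bt ->] [et ->]].
by rewrite mulf_div !hornerM.
Qed.

Lemma germX f F m : germ f F -> germ (fun t => f t ^+ m) (F ^+ m).
Proof.
move=> [a [b [b0 -> h]]]; rewrite expr_div_n -!tofracXn.
apply: germ_ratio; first exact: expf_neq0.
by apply: generically_sub h => t [bt ->]; rewrite expr_div_n !horner_exp.
Qed.

Lemma germ_sum (I : Type) (r : seq I) (f : I -> k -> k)
    (F : I -> {fraction {poly k}}) : (forall i, germ (f i) (F i)) ->
  germ (fun t => \sum_(i <- r) f i t) (\sum_(i <- r) F i).
Proof.
move=> h; elim: r => [|i r IH].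
  by rewrite big_nil; apply: (eq_germ germ0) => t; rewrite big_nil.
rewrite big_cons; apply: (eq_germ (germD (h i) IH)) => t.
by rewrite big_cons.
Qed.

Definition germ_mx m n (A : k -> 'M[k]_(m, n))
    (B : 'M[{fraction {poly k}}]_(m, n)) :=
  forall i j, germ (fun t => A t i j) (B i j).

Lemma germ_mxM m n l (A : k -> 'M[k]_(m, n)) (B : k -> 'M[k]_(n, l)) A' B' :
  germ_mx A A' -> germ_mx B B' -> germ_mx (fun t => A t *m B t) (A' *m B').
Proof.
move=> hA hB i j; rewrite mxE.
apply: (eq_germ (germ_sum _ (fun s => germM (hA i s) (hB s j)))) => t.
by rewrite mxE.
Qed.

Lemma germ_mx_uniq m n (A B : k -> 'M[k]_(m, n)) A' B' :
  generically (fun t => A t = B t) -> germ_mx A A' -> germ_mx B B' -> A' = B'.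
Proof.
move=> AB hA hB; apply/matrixP => i j; apply: germ_uniq (hA i j) (hB i j).
by apply: generically_sub AB => t ->.
Qed.

Lemma germ_mx1 m : germ_mx (fun=> 1%:M : 'M_m) 1%:M.
Proof.
move=> i j; rewrite !mxE; case: (i == j); first exact: germ1.
exact: germ0.
Qed.

End Germs.

Section Places.

Lemma leq_pred_add a b c d : (a <= b -> c <= d -> (a + c).-1 <= (b + d).-1)%N.
Proof. by lia. Qed.

Lemma ltn_pred_add a b c d :
  (a < b -> c <= d -> 0 < d -> (a + c).-1 < (b + d).-1)%N.
Proof. by lia. Qed.

Variable k : closedFieldType.
Implicit Types (tau : option k) (F G : {fraction {poly k}}).

Definition Dt : {fraction {poly k}} -> {fraction {poly k}} :=
  frac_deriv (@deriv k).

(** A place of the projective line is [Some t] for the point [t] of the affine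
line and [None] for the point at infinity.  At infinity a fraction is regular
when the degree of the numerator does not exceed that of the denominator. *)
Definition regular_denominator tau (a b : {poly k}) : Prop :=
  b != 0 /\ if tau is Some t then b.[t] != 0 else (size a <= size b)%N.

Definition regular_place tau F : Prop :=
  exists a b : {poly k}, F = a%:F / b%:F /\ regular_denominator tau a b.

Definition vanishing_at_infinity F : Prop :=
  exists a b : {poly k}, [/\ b != 0, F = a%:F / b%:F & (size a < size b)%N].

Lemma regular_placeM tau F G :
  regular_place tau F -> regular_place tau G -> regular_place tau (F * G).
Proof.
move=> [a [b [-> [b0 hb]]]] [c [e [-> [e0 he]]]].
exists (a * c), (b * e); rewrite mulf_div -!tofracM; split=> //.
split; first exact: mulf_neq0.
case: tau hb he => [t|] hb he; first by rewrite hornerM mulf_neq0.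
have [->|a0] := eqVneq a 0; first by rewrite mul0r size_poly0.
have [->|c0] := eqVneq c 0; first by rewrite mulr0 size_poly0.
by rewrite !size_mul //; apply: leq_pred_add.
Qed.

Lemma regular_placeD tau F G :
  regular_place tau F -> regular_place tau G -> regular_place tau (F + G).
Proof.
move=> [a [b [-> [b0 hb]]]] [c [e [-> [e0 he]]]].
exists (a * e + c * b), (b * e).
rewrite addf_div ?tofrac_eq0 // -!tofracM -tofracD; split=> //.
split; first exact: mulf_neq0.
case: tau hb he => [t|] hb he; first by rewrite hornerM mulf_neq0.
apply: leq_trans (size_polyD _ _) _; rewrite geq_max (size_mul b0 e0).
apply/andP; split; apply: leq_trans (size_polyMleq _ _) _.
  exact: leq_pred_add.
by rewrite addnC; apply: leq_pred_add.
Qed.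

Lemma regular_place0 tau : regular_place tau 0.
Proof.
exists 0, 1; rewrite tofrac0 mul0r; split=> //; split; first exact: oner_neq0.
by case: tau => [t|]; rewrite ?hornerC ?oner_neq0 ?size_poly0.
Qed.

Lemma regular_place_sum tau (I : Type) (r : seq I)
    (F : I -> {fraction {poly k}}) :
  (forall i, regular_place tau (F i)) ->
  regular_place tau (\sum_(i <- r) F i).
Proof.
move=> h; elim/big_rec: _ => [|i x _]; first exact: regular_place0.
exact: regular_placeD.
Qed.

Let dM (a b : {poly k}) : (a * b)^`() = a^`() * b + a * b^`() := derivM a b.

Lemma Dt_regular t F : regular_place (Some t) F -> regular_place (Some t) (Dt F).
Proof.
move=> [a [b [-> [b0 hb]]]]; exists (a^`() * b - a * b^`()), (b ^+ 2).
rewrite /Dt frac_derivE //; split=> //; split; first exact: expf_neq0.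
by rewrite horner_exp expf_neq0.
Qed.

(** Differentiation lowers the degree of a fraction, so a function without pole
at infinity has a derivative that vanishes there. *)
Lemma Dt_vanishing F : regular_place None F -> vanishing_at_infinity (Dt F).
Proof.
move=> [a [b [-> [b0 hb]]]]; exists (a^`() * b - a * b^`()), (b ^+ 2).
rewrite /Dt frac_derivE //; split=> //; first exact: expf_neq0.
rewrite expr2 size_mul //; apply: leq_ltn_trans (size_polyD _ _) _.
rewrite size_polyN gtn_max; have b1 : (0 < size b)%N by rewrite size_poly_gt0.
have lb : (size b^`() < size b)%N by apply: lt_size_deriv.
have la : (size a^`() < size b)%N.
  have [->|a0] := eqVneq a 0; first by rewrite linear0 size_poly0.
  exact: leq_trans (lt_size_deriv a0) hb.
rewrite !(leq_ltn_trans (size_polyMleq _ _)) //.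
  by rewrite addnC; apply: ltn_pred_add.
exact: ltn_pred_add.
Qed.

Lemma vanishingM F G : vanishing_at_infinity F -> regular_place None G ->
  vanishing_at_infinity (F * G).
Proof.
move=> [a [b [b0 -> hb]]] [c [e [-> [e0 he]]]].
exists (a * c), (b * e); rewrite mulf_div -!tofracM; split=> //.
  exact: mulf_neq0.
have e1 : (0 < size e)%N by rewrite size_poly_gt0.
rewrite (size_mul b0 e0); apply: leq_ltn_trans (size_polyMleq _ _) _.
exact: ltn_pred_add.
Qed.

Lemma vanishingD F G : vanishing_at_infinity F -> vanishing_at_infinity G ->
  vanishing_at_infinity (F + G).
Proof.
move=> [a [b [b0 -> hb]]] [c [e [e0 -> he]]].
exists (a * e + c * b), (b * e).
rewrite addf_div ?tofrac_eq0 // -!tofracM -tofracD; split=> //.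
  exact: mulf_neq0.
have e1 : (0 < size e)%N by rewrite size_poly_gt0.
have b1 : (0 < size b)%N by rewrite size_poly_gt0.
apply: leq_ltn_trans (size_polyD _ _) _; rewrite gtn_max (size_mul b0 e0).
apply/andP; split; apply: leq_ltn_trans (size_polyMleq _ _) _.
  exact: ltn_pred_add.
have := ltn_pred_add he (leqnn (size b)) b1.
by rewrite [(size e + _)%N]addnC.
Qed.

Lemma vanishing_sum (I : Type) (r : seq I) (F : I -> {fraction {poly k}}) :
  (forall i, vanishing_at_infinity (F i)) ->
  vanishing_at_infinity (\sum_(i <- r) F i).
Proof.
move=> h; elim/big_rec: _ => [|i x _]; last exact: vanishingD.
by exists 0, 1; rewrite oner_neq0 tofrac0 mul0r size_poly0 size_poly1.
Qed.

(** The projective line carries no nonzero global differential: in lowest terms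
the denominator of [F] has no root, so [F] is a polynomial, and the only
polynomial vanishing at infinity is zero. *)
Lemma no_global_differentials F : (forall t, regular_place (Some t) F) ->
  vanishing_at_infinity F -> F = 0.
Proof.
move=> hF [a [b [b0 Fab hab]]].
pose g := gcdp a b; pose a' := a %/ g; pose b' := b %/ g.
have g0 : g != 0 by rewrite gcdp_eq0 negb_and b0 orbT.
have aE : a = a' * g by rewrite divpK ?dvdp_gcdl.
have bE : b = b' * g by rewrite divpK ?dvdp_gcdr.
have b'0 : b' != 0 by apply: contraNneq b0; rewrite bE => ->; rewrite mul0r.
have co : coprimep b' a' by rewrite coprimep_sym coprimep_div_gcd // b0 orbT.
have Fab' : F = a'%:F / b'%:F.
  rewrite Fab; apply/eqP; rewrite fraction_eq //.
  by rewrite aE bE mulrAC mulrA.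
have sb : size b' == 1%N.
  apply/negPn/negP => /closed_rootP[t /rootP rt].
  have [c [e [Fce [e0 et]]]] := hF t.
  move: Fab'; rewrite Fce => /eqP; rewrite fraction_eq // => /eqP E.
  have : b' %| a' * e by rewrite -E dvdp_mull.
  rewrite Gauss_dvdpr // => /dvdpP[q eq].
  by move: et; rewrite eq hornerM rt mulr0 eqxx.
have : (size a' < 1)%N.
  have [->|a'0] := eqVneq a' 0; first by rewrite size_poly0.
  move: hab; rewrite aE bE !size_mul // (eqP sb).
  rewrite add1n /=; case: (size a') => // m.
  by rewrite addSn /= ltnNge leq_addl.
by rewrite ltnS leqn0 size_poly_eq0 Fab' => /eqP ->; rewrite tofrac0 mul0r.
Qed.

End Places.

(** * Bundles along rational curves *)

Section TopCoefficient.
Variable R : comNzRingType.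

(** The coefficient in degree [m], for polynomials of degree at most [m]; it is
the value at infinity of a section of O(m) on the projective line, and is
therefore multiplicative. *)
Definition top_coef m (f : {poly R}) (c : R) : Prop :=
  (size f <= m.+1)%N /\ f`_m = c.

Lemma top_coefC c : top_coef 0 c%:P c.
Proof. by split; rewrite ?coefC // size_polyC leq_b1. Qed.

Lemma top_coefM m n f g a b : top_coef m f a -> top_coef n g b ->
  top_coef (m + n) (f * g) (a * b).
Proof.
move=> [sf <-] [sg <-]; split.
  apply: leq_trans (size_polyMleq _ _) _.
  by apply: leq_trans (leq_pred_add sf sg) _; rewrite addnS addSn.
have lm : (m < (m + n).+1)%N by rewrite ltnS leq_addr.
rewrite coefM (bigD1 (Ordinal lm)) //= addKn big1 ?addr0 // => i ne.
have [im|mi|e] := ltngtP i m; last by case/eqP: ne; apply/val_inj.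
  rewrite [g`_ _]nth_default ?mulr0 // (leq_trans sg) // ltn_subRL.
  by rewrite [ltnRHS]addnC addnC ltn_add2l.
by rewrite [f`_ _]nth_default ?mul0r // (leq_trans sf).
Qed.

Lemma top_coefX m f a e : top_coef m f a -> top_coef (m * e) (f ^+ e) (a ^+ e).
Proof.
move=> h; elim: e => [|e IH]; first by rewrite muln0 !expr0; apply: top_coefC.
by rewrite mulnS !exprS; apply: top_coefM.
Qed.

Lemma top_coef_mmap n m (h : 'I_n -> {poly R}) (c : 'I_n -> R) d
    (a : {mpoly R[n]}) : (forall i, top_coef m (h i) (c i)) -> a \is d.-homog ->
  top_coef (m * d) (mmap (@polyC R) h a) a.@[c].
Proof.
move=> hc /dhomogP ha; rewrite mevalE /mmap !big_seq.
elim/big_rec2: _ => [|e x y /ha de [sy <-]].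
  by split; rewrite ?size_poly0 ?coef0.
suff [s1 <-] : top_coef (m * d) ((a@_e)%:P * mmap1 h e)
    (a@_e * \prod_i c i ^+ e i).
  split; last by rewrite coefD.
  by rewrite (leq_trans (size_polyD _ _)) // geq_max s1.
rewrite -[(m * d)%N]add0n; apply: top_coefM; first exact: top_coefC.
have -> : (m * d = \sum_(i < n) m * e i)%N by rewrite -big_distrr -mdegE -de.
rewrite /mmap1; elim/big_rec3: _ => [|i x1 x2 x3 _ IH]; first exact: top_coefC.
by apply: top_coefM => //; apply: top_coefX.
Qed.

End TopCoefficient.

Section Curve.
Variables (k : closedFieldType) (N : nat) (X : variety k N).
Variable delta : 'I_N.+1 -> {poly k}.
Hypothesis delta_neq0 : forall t, exists i, (delta i).[t] != 0.

Definition curve_degree : nat := (\max_(i < N.+1) size (delta i)).-1.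

(** At infinity the coordinates are the coefficients in the largest degree that
occurs, one of which is nonzero. *)
Definition curve_coord (tau : option k) (i : 'I_N.+1) : k :=
  if tau is Some t then (delta i).[t] else (delta i)`_curve_degree.

Definition curve_point tau : pspace k N := point (curve_coord tau).

Hypothesis curve_generic : generically (fun t => X (curve_point (Some t))).

Local Notation pull a := (mmap (@polyC k) delta a).

Lemma curve_coord_neq0 tau : exists i, curve_coord tau i != 0.
Proof.
case: tau => [t|]; first exact: delta_neq0.
have c0 : (0 < #|'I_N.+1|)%N by rewrite card_ord.
have [i0 e] := eq_bigmax (fun i => size (delta i)) c0.
exists i0; rewrite /= /curve_degree e -lead_coefE lead_coef_eq0.
apply/eqP => d0; have [i] := delta_neq0 0.
have : (size (delta i) <= size (delta i0))%N.
  by rewrite -e; apply: (leq_bigmax (F := fun i => size (delta i))).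
by rewrite d0 size_poly0 leqn0 size_poly_eq0 => /eqP ->; rewrite horner0 eqxx.
Qed.

Lemma curve_point_val tau :
  val (curve_point tau) = <[\row_i curve_coord tau i]>%VS.
Proof. exact/point_val/curve_coord_neq0. Qed.

Lemma pull_top d (a : {mpoly k[N.+1]}) : a \is d.-homog ->
  top_coef (curve_degree * d) (pull a) a.@[curve_coord None].
Proof.
apply: top_coef_mmap => i; split=> //.
apply: leq_trans (leqSpred _); apply: (leq_bigmax (F := fun i => size (delta i))).
Qed.

Lemma pull_neq0 tau d (a : {mpoly k[N.+1]}) : a \is d.-homog ->
  a.@[curve_coord tau] != 0 -> pull a != 0.
Proof.
move=> ha nz; apply: contraNneq nz => e; apply/eqP.
case: tau => [t|]; first by rewrite -horner_mmap e horner0.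
by have [_ <-] := pull_top ha; rewrite e coef0.
Qed.

Lemma pull_regular tau d (a b : {mpoly k[N.+1]}) :
  a \is d.-homog -> b \is d.-homog -> b.@[curve_coord tau] != 0 ->
  regular_denominator tau (pull a) (pull b).
Proof.
move=> ha hb nz; split; first exact: pull_neq0 hb nz.
case: tau nz => [t|] nz; first by rewrite horner_mmap.
have [sa _] := pull_top ha; apply: leq_trans sa _; rewrite ltnNge.
have [_ e] := pull_top hb; apply: contra nz => /(nth_default 0).
by rewrite e => ->.
Qed.

(** An equation of [X] pulls back to a polynomial with infinitely many zeros, so
it holds along the whole curve, the point at infinity included. *)
Lemma curve_point_in tau : X (curve_point tau).
Proof.
have [S [hS XE]] := pts_closed X; apply/XE => f Sf.
have [d hf] := hS f Sf; apply/eqP.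
rewrite (peval_eq0 (curve_point_val tau) hf); apply/negPn/negP.
move/(pull_neq0 hf)/eqP; apply; apply: poly_eq0_generically.
apply: generically_sub curve_generic => t /XE/(_ f Sf)/eqP.
by rewrite (peval_eq0 (curve_point_val (Some t)) hf) horner_mmap => /eqP.
Qed.

Lemma open_generically U tau : open_in X U -> U (curve_point tau) ->
  generically (fun t => U (curve_point (Some t))).
Proof.
move=> [Z [S [hS ZE]] UE] /UE[_ nZ].
have [f [Sf nf]] : exists f, S f /\ peval f (curve_point tau) != 0.
  apply: NNPP => H; apply/nZ/ZE => f Sf; apply/eqP/negPn/negP => nf.
  by apply: H; exists f.
have [d hf] := hS f Sf; exists (pull f) => [|t nt].
  by move: nf; rewrite (peval_eq0 (curve_point_val tau) hf); apply: pull_neq0 hf.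
apply/UE; split; first exact: curve_point_in.
move/ZE/(_ f Sf)/eqP; rewrite (peval_eq0 (curve_point_val (Some t)) hf).
by rewrite -horner_mmap; apply/negP.
Qed.

Lemma ratio_germ W f tau d (a b : {mpoly k[N.+1]}) :
  open_in X W -> W (curve_point tau) -> a \is d.-homog -> b \is d.-homog ->
  (forall y, W y -> peval b y != 0 /\ f y = peval a y / peval b y) ->
  regular_denominator tau (pull a) (pull b) /\
  germ (fun t => f (curve_point (Some t))) ((pull a)%:F / (pull b)%:F).
Proof.
move=> oW Wx ha hb ab.
have reg : regular_denominator tau (pull a) (pull b).
  apply: (pull_regular ha hb).
  by rewrite -(peval_eq0 (curve_point_val tau) hb); case: (ab _ Wx).
split=> //; apply: germ_ratio; first by case: reg.
apply: generically_sub (open_generically oW Wx) => t /ab[_ ->].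
by rewrite (peval_ratio (curve_point_val (Some t)) ha hb) !horner_mmap.
Qed.

Lemma regular_germ U f tau : open_in X U -> U (curve_point tau) ->
  regular X U f -> exists F, regular_place tau F /\
    germ (fun t => f (curve_point (Some t))) F.
Proof.
move=> oU Ux /(_ _ Ux)[W [d [a [b [oW Wx ha hb ab]]]]].
have [||reg g] := ratio_germ (open_inI oW oU) (tau := tau) _ ha hb (f := f).
- by [].
- by move=> y [Wy Uy]; apply: ab.
by exists ((pull a)%:F / (pull b)%:F); split=> //; exists (pull a), (pull b).
Qed.

Lemma regular_germ_mx U m n (A : pspace k N -> 'M[k]_(m, n)) tau :
  open_in X U -> U (curve_point tau) ->
  (forall i j, regular X U (fun x => A x i j)) ->
  exists B : 'M[{fraction {poly k}}]_(m, n),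
    (forall i j, regular_place tau (B i j)) /\
    germ_mx (fun t => A (curve_point (Some t))) B.
Proof.
move=> oU Ux rA.
have /fin_all_exists[F hF] i : exists F : 'I_n -> {fraction {poly k}}, forall j,
    regular_place tau (F j) /\
    germ (fun t => A (curve_point (Some t)) i j) (F j).
  exact: (fin_all_exists (fun j => regular_germ oU Ux (rA i j))).
exists (\matrix_(i, j) F i j); split=> i j; rewrite mxE; by case: (hF i j).
Qed.

Section Frame.
Variables (p : nat) (hp : p \in [pchar k]).
Variables (V : vbundle X) (r : nat).
Variables (u : idx V -> pspace k N -> 'M[k]_(r, rk V))
          (v : idx V -> pspace k N -> 'M[k]_(rk V, r)).
Hypothesis u_regular : forall i s t, regular X (chart i) (fun x => u i x s t).
Hypothesis v_regular : forall i s t, regular X (chart i) (fun x => v i x s t).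
Hypothesis uvK : forall i x, chart i x -> u i x *m v i x = 1%:M.
Hypothesis vuK : forall i x, chart i x -> v i x *m u i x = 1%:M.
Hypothesis u_trans : forall i j x, chart i x -> chart j x ->
  u i x *m map_mx (fun c => c ^+ p) (trans i j x) = u j x.

Local Notation D := (map_mx (@Dt k)).
Local Notation along A := (fun t => A (curve_point (Some t))).

Let dD : {morph @deriv k : a b / a + b}. Proof. exact: raddfD. Qed.
Let dM (a b : {poly k}) : (a * b)^`() = a^`() * b + a * b^`().
Proof. exact: derivM. Qed.

Lemma Dt_mulmx m n l (A : 'M[{fraction {poly k}}]_(m, n))
  (B : 'M[{fraction {poly k}}]_(n, l)) : D (A *m B) = D A *m B + A *m D B.
Proof. exact: frac_deriv_mulmx. Qed.

(** With [u_j = u_i G] where the entries of [G] are [p]-th powers, the derivative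
of [G] is zero, and so [u_j' u_j^-1 = u_i' G G^-1 u_i^-1 = u_i' u_i^-1]. *)
Lemma log_deriv_chart tau sigma i j (A A' : 'M_(r, rk V))
    (B B' : 'M_(rk V, r)) :
  chart i (curve_point tau) -> chart j (curve_point sigma) ->
  germ_mx (along (u i)) A -> germ_mx (along (v i)) B ->
  germ_mx (along (u j)) A' -> germ_mx (along (v j)) B' ->
  [/\ A *m B = 1%:M, B *m A = 1%:M & D A *m B = D A' *m B'].
Proof.
move=> ci cj hA hB hA' hB'.
have gi := open_generically (chart_open i) ci.
have gj := open_generically (chart_open j) cj.
have AB : A *m B = 1%:M.
  apply: germ_mx_uniq (germ_mxM hA hB) (@germ_mx1 _ _).
  by apply: generically_sub gi => t /uvK.
have BA : B *m A = 1%:M.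
  apply: germ_mx_uniq (germ_mxM hB hA) (@germ_mx1 _ _).
  by apply: generically_sub gi => t /vuK.
have AB' : A' *m B' = 1%:M.
  apply: germ_mx_uniq (germ_mxM hA' hB') (@germ_mx1 _ _).
  by apply: generically_sub gj => t /uvK.
have gij := generically_and gi gj; have [t0 c0] := generically_exists gij.
have [G [_ hG]] := regular_germ_mx (tau := Some t0)
  (open_inI (chart_open i) (chart_open j)) c0 (@trans_regular _ _ _ V i j).
pose Gp := map_mx (fun c => c ^+ p) G.
have hGp : germ_mx (along (fun x => map_mx (fun c => c ^+ p) (trans i j x))) Gp.
  move=> s t; rewrite mxE; apply: (eq_germ (germX p (hG s t))) => t1.
  by rewrite mxE.
have AE : A' = A *m Gp.
  apply: germ_mx_uniq hA' (germ_mxM hA hGp).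
  by apply: generically_sub gij => t [ct1 ct2]; rewrite u_trans.
have DG : D Gp = 0.
  apply/matrixP => s t; rewrite !mxE; apply: frac_derivXp => //.
  by rewrite (rmorph_pchar (@tofrac _)) // pchar_poly.
split=> //; rewrite AE Dt_mulmx DG mulmx0 addr0 -mulmxA; congr (_ *m _).
by rewrite -[RHS]mul1mx -BA -mulmxA [A *m _]mulmxA -AE AB' mulmx1.
Qed.

(** Near each place of the projective line the matrix [u' u^-1] can be computed
in a chart around that place, so its entries are global differentials. *)
Lemma frame_deriv0 i tau (A : 'M_(r, rk V)) (B : 'M_(rk V, r)) :
  chart i (curve_point tau) ->
  germ_mx (along (u i)) A -> germ_mx (along (v i)) B ->
  D A = 0 /\ D B = 0.
Proof.
move=> ci hA hB; have [AB BA _] := log_deriv_chart ci ci hA hB hA hB.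
have reg sigma : exists (A' : 'M_(r, rk V)) (B' : 'M_(rk V, r)),
    [/\ forall s t, regular_place sigma (A' s t),
        forall s t, regular_place sigma (B' s t) & D A *m B = D A' *m B'].
  have [j cj] := chart_cover V (curve_point_in sigma).
  have [A' [rA' hA']] := regular_germ_mx (chart_open j) cj (@u_regular j).
  have [B' [rB' hB']] := regular_germ_mx (chart_open j) cj (@v_regular j).
  exists A', B'; split=> //.
  by have [_ _ ->] := log_deriv_chart ci cj hA hB hA' hB'.
have W0 : D A *m B = 0.
  apply/matrixP => s t; rewrite [RHS]mxE; apply: no_global_differentials => [t0|].
    have [A1 [B1 [rA rB ->]]] := reg (Some t0).
    rewrite mxE; apply: regular_place_sum => l.
    by apply: regular_placeM (rB l t); rewrite mxE; apply: Dt_regular.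
  have [A1 [B1 [rA rB ->]]] := reg None.
  rewrite mxE; apply: vanishing_sum => l.
  by apply: vanishingM (rB l t); rewrite mxE; apply: Dt_vanishing.
have DA : D A = 0 by rewrite -[LHS]mulmx1 -BA mulmxA W0 mul0mx.
split=> //; have := congr1 D AB; rewrite Dt_mulmx DA mul0mx add0r.
rewrite [D 1%:M]frac_deriv_scalar // => /(congr1 (mulmx B)).
by rewrite mulmxA BA mul1mx mulmx0.
Qed.

End Frame.
End Curve.

(** * Pulling back to projective space *)

Section CoprimeCoordinates.
Variable k : closedFieldType.

(** Removing the common factor is what turns a rational curve in [X] into one
defined at every parameter. *)
Lemma extract_common_factor n (gamma : 'I_n -> {poly k}) i0 : gamma i0 != 0 ->
  exists (g : {poly k}) (delta : 'I_n -> {poly k}),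
    [/\ g != 0, forall i, gamma i = g * delta i &
        forall t, exists i, (delta i).[t] != 0].
Proof.
have [m] := ubnP (size (gamma i0)); elim: m gamma => // m IH gamma sz g0.
have [[t ht]|nt] := classic (exists t, forall i, (gamma i).[t] = 0); last first.
  exists 1, gamma; split=> [|i|t]; [exact: oner_neq0|by rewrite mul1r|].
  apply: NNPP => H; apply: nt; exists t => i; apply/eqP/negPn/negP => hi.
  by apply: H; exists i.
pose gamma' i := gamma i %/ ('X - t%:P).
have gE i : gamma i = gamma' i * ('X - t%:P).
  by rewrite divpK // dvdp_XsubCl; apply/rootP.
have g'0 : gamma' i0 != 0.
  by apply: contraNneq g0 => e; rewrite gE e mul0r.
have [|g [delta [gn0 e nz]]] := IH gamma' _ g'0.
  rewrite -ltnS; apply: leq_trans sz; rewrite ltnS gE size_Mmonic ?monicXsubC //.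
  by rewrite size_XsubC addn2.
exists (g * ('X - t%:P)), delta; split=> // [|i].
  by rewrite mulf_neq0 // polyXsubC_eq0.
by rewrite gE e mulrAC.
Qed.

Lemma point_scale N (v w : 'I_N.+1 -> k) c : c != 0 -> (exists i, v i != 0) ->
  (forall i, w i = c * v i) -> point w = point v.
Proof.
move=> c0 v0 wv; have w0 : exists i, w i != 0.
  by case: v0 => i vi; exists i; rewrite wv mulf_neq0.
apply: point_eq; rewrite point_val //; apply/eqP.
have -> : \row_i w i = c *: \row_i v i by apply/rowP => i; rewrite !mxE wv.
rewrite eqEdim !dim_vline -memvE memvZ ?memv_line //=.
by rewrite scaler_eq0 (negPf c0).
Qed.

End CoprimeCoordinates.

Section Unirational.
Variables (k : closedFieldType) (p : nat) (hp : p \in [pchar k]).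
Variables (n N : nat) (X : variety k N) (phi : N.+1.-tuple {mpoly k[n.+1]}).
Hypotheses (phi_map : rational_map_to X phi) (phi_dom : dominant X phi).

Local Notation image w := (fun i => (tnth phi i).@[w]).

Lemma image_in (w : 'I_n.+1 -> k) : (exists l, w l != 0) ->
  (exists i, (tnth phi i).@[w] != 0) -> X (point (image w)).
Proof.
case: phi_map => -[d hd] _ hX w0 i0; apply: (hX (point w)); split.
  case: i0 => i; rewrite -(peval_eq0 (point_val w0) (hd i)) => nz.
  by apply/eqP => /rowP/(_ i)/eqP; rewrite !mxE (negPf nz).
have [c c0 e] := peval_scale (point_val w0).
rewrite -(@point_scale _ _ _ (fun i => peval (tnth phi i) (point w)) (c ^+ d)) //.
- rewrite point_val //; case: i0 => i nz; exists i.
  by rewrite (peval_eq0 (point_val w0) (hd i)).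
- exact: expf_neq0.
- by move=> i; rewrite (e _ _ (hd i)).
Qed.

(** By dominance some point outside the complement of [W] is an image point, so
one of the equations of this complement pulls back to a nonzero polynomial;
[h] is its product with a nonzero coordinate of [phi]. *)
Lemma image_open W : open_in X W -> (exists x, W x) ->
  exists h : {mpoly k[n.+1]}, [/\ h != 0,
    forall w, h.@[w] != 0 -> exists i, (tnth phi i).@[w] != 0 &
    forall w, h.@[w] != 0 -> (exists l, w l != 0) -> W (point (image w))].
Proof.
move=> [Z cZ WE] [x Wx]; have [Xx nZx] := (WE x).1 Wx.
have [x0 [y0 [[v0 y0E] nZ]]] : exists x0 y0, phi_graph phi x0 y0 /\ ~ Z y0.
  apply: NNPP => H; apply: nZx; apply: (phi_dom cZ _ Xx) => a b ab.
  apply: NNPP => nZ.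
  by apply: H; exists a, b.
case: cZ => S [hS ZE].
have [f [Sf nf]] : exists f, S f /\ peval f y0 != 0.
  apply: NNPP => H; apply/nZ/ZE => f Sf; apply/eqP/negPn/negP => nf.
  by apply: H; exists f.
have [d hf] := hS f Sf.
have [_ [i1 i1P] _] := phi_map.
exists ((f \mPo phi) * tnth phi i1); split.
- apply: mulf_neq0 => //; move: nf; rewrite (peval_eq0 y0E hf).
  by apply: contraNneq => e; rewrite -comp_mpoly_meval e meval0.
- by move=> w; rewrite mevalM mulf_eq0 negb_or => /andP[_ nz]; exists i1.
move=> w; rewrite mevalM mulf_eq0 negb_or comp_mpoly_meval => /andP[nz nz1] w0.
apply/WE; split; first by apply: image_in => //; exists i1.
move/ZE/(_ f Sf)/eqP; rewrite (peval_eq0 (point_val _) hf); last by exists i1.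
exact/negP.
Qed.

Lemma pullback_zero d (h : {mpoly k[N.+1]}) : h \is d.-homog ->
  h \mPo phi = 0 -> forall y, X y -> peval h y = 0.
Proof.
move=> hh h0; apply: phi_dom; first exact: closed_zeros hh.
move=> x y [_ yE]; apply/eqP; rewrite (peval_eq0 yE hh).
by rewrite -comp_mpoly_meval h0 meval0.
Qed.

(** The condition satisfied by the entries of the frames of a Frobenius
pullback: zero derivative along every complete rational curve in [X]. *)
Definition constant_along_curves (U : pspace k N -> Prop) (f : pspace k N -> k) :=
  forall (delta : 'I_N.+1 -> {poly k}),
    (forall t, exists i, (delta i).[t] != 0) ->
    generically (fun t => X (curve_point delta (Some t))) ->
    forall t F, U (curve_point delta (Some t)) ->
    germ (fun s => f (curve_point delta (Some s))) F -> Dt F = 0.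

(** The identity says that the [l]-th partial derivative of [f o phi], where
[f = a / b], is zero.  At a general point [w] it is the derivative at [0] of
the restriction to the coordinate line through [w], and that line maps to a
rational curve in [X]. *)
Lemma wronskian_pullback U f d (a b : {mpoly k[N.+1]}) W :
  constant_along_curves U f -> open_in X W -> (exists x, W x) ->
  (forall y, W y -> U y) -> a \is d.-homog -> b \is d.-homog ->
  (forall y, W y -> peval b y != 0 /\ f y = peval a y / peval b y) ->
  b \mPo phi != 0 /\ forall l,
    (a \mPo phi)^`M(l) * (b \mPo phi) = (a \mPo phi) * (b \mPo phi)^`M(l).
Proof.
move=> cf oW neW WU ha hb ab; have [h [h0 hi hW]] := image_open oW neW.
(* The factor 'X_l makes w nonzero, so that it represents a point. *)
pose Q l := h * 'X_l.
have Q0 l : Q l != 0.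
  rewrite mulf_neq0 //; apply/eqP => /(congr1 (meval (fun=> 1)))/eqP.
  by rewrite mevalXU meval0 oner_eq0.
have QE l w : (Q l).@[w] != 0 -> h.@[w] != 0 /\ w l != 0.
  by rewrite mevalM mevalXU mulf_eq0 negb_or => /andP.
split.
  have [w /QE[hw w0]] := mpoly_nonroot (Q0 ord0).
  have [|/negP] := ab (point (image w)).
    by apply: hW => //; exists ord0.
  rewrite (peval_eq0 (point_val (hi _ hw)) hb) => nz _; apply/eqP => e.
  by apply: nz; rewrite -comp_mpoly_meval e meval0.
move=> l; apply/eqP; rewrite -subr_eq0 -(mulIr_eq0 _ (mulIf (Q0 l))).
apply/eqP/mpoly_eq0_eval => w; rewrite mevalM; apply/eqP.
have [->|/QE[hw wl]] := eqVneq (Q l).@[w] 0; first by rewrite mulr0.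
rewrite mulf_eq0; apply/orP; left.
pose gamma i := mmap (@polyC k) (coord_line w l) (tnth phi i).
have line0 : (fun i => (coord_line w l i).[0]) =1 w.
  by move=> i; rewrite /coord_line hornerD hornerC hornerZ hornerX mulr0 addr0.
have gammaE i t : (gamma i).[t] = (tnth phi i).@[fun i => (coord_line w l i).[t]].
  by rewrite /gamma horner_mmap.
have [i1 hi1] := hi w hw.
have gi1 : (gamma i1).[0] != 0 by rewrite gammaE (meval_eq _ line0).
have g1 : gamma i1 != 0 by apply: contraNneq gi1 => ->; rewrite horner0.
have [g [delta [g0 gE dn0]]] := extract_common_factor g1.
have curveE t : g.[t] != 0 ->
    curve_point delta (Some t) = point (fun i => (gamma i).[t]).
  move=> gt; apply/esym; apply: (point_scale gt (dn0 t)) => i.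
  by rewrite gE hornerM.
have gen : generically (fun t => X (curve_point delta (Some t))).
  exists (g * coord_line w l l) => [|t].
    apply: mulf_neq0 => //; apply: contraNneq wl => e.
    by rewrite -(line0 l) e horner0.
  rewrite hornerM mulf_eq0 negb_or => /andP[gt lt]; rewrite curveE //.
  have [i di] := dn0 t; have := @image_in (fun i => (coord_line w l i).[t]).
  have -> : point (image (fun i => (coord_line w l i).[t]))
     = point (fun i => (gamma i).[t]).
    apply: (@point_scale _ _ _ _ 1); rewrite ?oner_neq0 //.
      by exists i; rewrite gE hornerM mulf_neq0.
    by move=> j; rewrite mul1r gammaE.
  by apply; [exists l|exists i; rewrite -gammaE gE hornerM mulf_neq0].
have g00 : g.[0] != 0.
  by apply: contraNneq gi1 => e; rewrite gE hornerM e mul0r.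
have Wd : W (curve_point delta (Some 0)).
  rewrite curveE //.
  have -> : point (fun i => (gamma i).[0]) = point (image w).
    apply: (@point_scale _ _ _ _ 1); rewrite ?oner_neq0 //; first exact: hi.
    by move=> j; rewrite mul1r gammaE; apply: meval_eq.
  by apply: hW => //; exists l.
have [[b0 _] gab] := ratio_germ dn0 gen (tau := Some 0) oW Wd ha hb ab.
have /eqP := cf _ dn0 gen 0 _ (WU _ Wd) gab.
set PA := mmap _ _ a in b0 gab *; set PB := mmap _ _ b in b0 gab *.
rewrite /Dt (frac_derivE (@derivM k)) //.
rewrite mulf_eq0 invr_eq0 !tofrac_eq0 expf_eq0 (negPf b0) orbF /= => dP.
(* The common factor g enters numerator and denominator in the same power, so
   it cancels from the Wronskian. *)
have pullE (c : {mpoly k[N.+1]}) : c \is d.-homog ->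
    mmap (@polyC k) (coord_line w l) (c \mPo phi) =
    g ^+ d * mmap (@polyC k) delta c.
  move=> hc; rewrite mmap_comp_mpoly -(mmap_homog_scale _ _ _ hc).
  by apply: eq_bigr => m _; congr (_ * _); apply: mmap1_eq.
have := deriv_coord_line w l (a \mPo phi).
have := deriv_coord_line w l (b \mPo phi).
rewrite !pullE // -/PA -/PB !derivM => dB dA.
have evalE (c : {mpoly k[n.+1]}) :
    c.@[w] = (mmap (@polyC k) (coord_line w l) c).[0].
  by rewrite horner_mmap; apply: meval_eq => i; rewrite line0.
rewrite mevalB !mevalM !evalE -dA -dB !pullE // -/PA -/PB.
rewrite -!hornerM -hornerN -hornerD.
suff -> : ((g ^+ d)^`() * PA + g ^+ d * PA^`()) * (g ^+ d * PB) -
   g ^+ d * PA * ((g ^+ d)^`() * PB + g ^+ d * PB^`()) = 0 by rewrite horner0.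
rewrite [LHS](_ : _ = g ^+ d * g ^+ d * (PA^`() * PB - PA * PB^`())); last first.
  by ring.
by rewrite (eqP dP) mulr0.
Qed.

Lemma pulled_back_subfield : is_subfield (pulled_back_field phi).
Proof.
split.
- exists 0%N, 1, 1; rewrite !rmorph1 divr1 oner_neq0.
  by split=> //; apply: dhomog1.
- move=> _ _ [d [a [b [ha hb b0 ->]]]] [e [a' [b' [ha' hb' b'0 ->]]]].
  exists (d + e)%N, (a * b' - a' * b), (b * b').
  split; rewrite ?rmorphM ?mulf_neq0 //; try exact: dhomogM.
    by apply: rpredB; [|rewrite addnC]; apply: dhomogM.
  by rewrite -mulNr addf_div ?tofrac_eq0 // !(rmorphB, rmorphM) mulNr.
- move=> _ _ [d [a [b [ha hb b0 ->]]]] [e [a' [b' [ha' hb' b'0 ->]]]].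
  exists (d + e)%N, (a * a'), (b * b').
  split; rewrite ?rmorphM ?mulf_neq0 //; try exact: dhomogM.
  by rewrite mulf_div ?rmorphM.
move=> _ [d [a [b [ha hb b0 ->]]]].
have [a0|a0] := eqVneq (comp_mpoly phi a) 0.
  exists 0%N, 0, 1; rewrite a0 !rmorph1 !raddf0 mul0r invr0 oner_neq0.
  by split; rewrite ?mul0r ?dhomog1 ?dhomog0.
by exists d, b, a; rewrite invf_div.
Qed.

(** If [A / B] has zero derivatives, so has [A B^(p-1) = (A / B) B^p], which is
therefore the [p]-th power of a polynomial; this makes [A / B] a [p]-th power
in the function field of projective space, and separability does the rest. *)
Lemma pullback_pth_power d (a b : {mpoly k[N.+1]}) :
  Defs.separable_map phi -> a \is d.-homog -> b \is d.-homog -> b \mPo phi != 0 ->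
  (forall l,
    (a \mPo phi)^`M(l) * (b \mPo phi) = (a \mPo phi) * (b \mPo phi)^`M(l)) ->
  exists e (a' b' : {mpoly k[N.+1]}),
    [/\ a' \is e.-homog, b' \is e.-homog, b' \mPo phi != 0 &
      forall y, X y -> peval a' y ^+ p * peval b y = peval a y * peval b' y ^+ p].
Proof.
move=> sep ha hb; set A := a \mPo phi; set B := b \mPo phi => B0 wr.
have [[D hD] _ _] := phi_map; have p0 := prime_gt0 (pcharf_prime hp).
have hA : A \is (D * d)%N.-homog by apply: comp_mpoly_homog.
have hB : B \is (D * d)%N.-homog by apply: comp_mpoly_homog.
have hpM : p \in [pchar {mpoly k[n.+1]}].
  exact: (rmorph_pchar (@mpolyC n.+1 k) hp).
have hpF : p \in [pchar {fraction {mpoly k[n.+1]}}].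
  exact: (rmorph_pchar (@tofrac _) hpM).
have derB l : (B ^+ p.-1)^`M(l) * B = - (B ^+ p.-1 * B^`M(l)).
  have derX m : (B ^+ m)^`M(l) * B = B ^+ m * B^`M(l) *+ m.
    elim: m => [|m IH]; first by rewrite expr0 -mpolyC1 mderivC mul0r mulr0n.
    rewrite exprS mderivM mulrDl mulrAC -[B * _ * B]mulrA IH mulrSr.
    by rewrite mulrnAr !mulrA [B^`M(l) * B]mulrC addrC; congr (_ + _); ring.
  by rewrite derX; apply/eqP; rewrite -addr_eq0 -mulrSr prednK // mulrn_pchar.
have der l : (A * B ^+ p.-1)^`M(l) = 0.
  apply: (mulIf B0); rewrite mul0r mderivM mulrDl -[A * _ * B]mulrA derB.
  by rewrite mulrAC wr; ring.
have [|c hc cE] := mpoly_pth_root hp (d := (D * d)%N) _ der.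
  have -> : (p * (D * d) = D * d + D * d * p.-1)%N.
    by rewrite -mulnS prednK // mulnC.
  exact: dhomogM hA (dhomogMn _ hB).
have : pulled_back_field phi (c%:F / B%:F).
  apply: (separable_ext_pth_root hpF pulled_back_subfield sep).
    by exists (D * d)%N, c, B.
  exists d, a, b; split=> //; rewrite expr_div_n -!tofracXn -cE.
  apply/eqP; rewrite fraction_eq ?expf_neq0 //; apply/eqP.
  by rewrite -/A -/B -mulrA -exprSr prednK.
case=> e [a' [b' [ha' hb' b'0 /eqP]]]; rewrite fraction_eq // => /eqP E.
exists e, a', b'; split=> // y Xy; apply/eqP; rewrite -subr_eq0.
have hh : a' ^+ p * b - a * b' ^+ p \is (e * p + d)%N.-homog.
  by apply: rpredB; [|rewrite addnC]; apply: dhomogM => //; apply: dhomogMn.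
have := pullback_zero hh _ Xy.
rewrite /peval mevalB !mevalM !rmorphXn /= => -> //.
rewrite rmorphB !rmorphM !rmorphXn /= -/A -/B.
apply: (mulIf (expf_neq0 p.-1 B0)); rewrite mul0r mulrBl -mulrA -exprS prednK //.
rewrite -exprMn -E exprMn -cE; ring.
Qed.

End Unirational.

(** * Roots of regular functions and descent of trivialisations *)

Section PthRoots.
Variables (k : closedFieldType) (p : nat) (hp : p \in [pchar k]).
Variables (n N : nat) (X : variety k N) (phi : N.+1.-tuple {mpoly k[n.+1]}).
Hypotheses (phi_map : rational_map_to X phi) (phi_dom : dominant X phi).
Hypothesis phi_sep : Defs.separable_map phi.

Lemma pullback_neq0 (b : {mpoly k[N.+1]}) d : b \is d.-homog ->
  b \mPo phi != 0 -> exists y, X y /\ peval b y != 0.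
Proof.
move=> hb b0; have neX : exists x, X x by case: (pts_irreducible X).
have [h [h0 hi hX]] := image_open phi_map phi_dom (open_in_full X) neX.
have X0 : ('X_ord0 : {mpoly k[n.+1]}) != 0.
  apply/eqP => /(congr1 (meval (fun=> 1)))/eqP.
  by rewrite mevalXU meval0 oner_eq0.
have [w] := mpoly_nonroot (mulf_neq0 (mulf_neq0 h0 b0) X0).
rewrite !mevalM mevalXU !mulf_eq0 !negb_or => /andP[/andP[hw bw] w0].
exists (point (fun i => (tnth phi i).@[w])); split.
  by apply: hX => //; exists ord0.
by rewrite (peval_eq0 (point_val (hi _ hw)) hb) -comp_mpoly_meval.
Qed.

Hypothesis X_normal : normal X.

(** By [wronskian_pullback] and [pullback_pth_power] the root of [f] is, on a
nonempty open set, a rational function [a' / b'].  It satisfies the monic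
equation [Y^p - f = 0], so normality extends it to a regular function at each
point of [U]; this extension is still a root of [f], and [p]-th roots are
unique. *)
Lemma pth_root_regular U f : open_in X U -> regular X U f ->
  constant_along_curves X U f -> regular X U (fun x => pth_root hp (f x)).
Proof.
move=> oU rf cf x Ux; have Xx := open_in_sub oU Ux.
have [W0 [d [a [b [oW0 W0x ha hb ab0]]]]] := rf x Ux.
pose W y := W0 y /\ U y.
have oW : open_in X W by apply: open_inI.
have ab y : W y -> peval b y != 0 /\ f y = peval a y / peval b y.
  by case=> w u; apply: ab0.
have [||b0 wr] := wronskian_pullback phi_map phi_dom cf oW _ _ ha hb ab.
- by exists x.
- by move=> y [].
have [e [a' [b' [ha' hb' b'0 E]]]] :=
  pullback_pth_power hp phi_map phi_dom phi_sep ha hb b0 wr.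
pose U' y := W y /\ (X y /\ peval b' y != 0).
have oU' : open_in X U' by apply: open_inI oW (open_nonzeros _ hb').
have neU' : exists y, U' y.
  apply: (open_meet oW (open_nonzeros _ hb')); first by exists x.
  exact: pullback_neq0 hb' b'0.
pose r y := peval a' y / peval b' y.
have rr : regular X U' r.
  move=> y Uy; exists U', e, a', b'; split=> //.
  by move=> z [_ [_ nz]] _.
have rp y : U' y -> r y ^+ p = f y.
  move=> [Wy [Xy nz]]; have [by0 ->] := ab y Wy.
  rewrite expr_div_n; apply/eqP; rewrite eqr_div ?expf_neq0 //; apply/eqP.
  exact: E.
have p0 := prime_gt0 (pcharf_prime hp).
have int : integral_at X x U' r.
  (* The coefficients of the equation Y^p - f = 0 below its leading term. *)
  exists p, U, (fun i y => if val i == 0%N then -1 * f y else 0).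
  split=> // [i|y U'y Uy].
    case: (val i == 0%N); last by apply: regular_const => y; apply: open_in_sub.
    have sub y : U y -> X y by apply: open_in_sub.
    exact: (regularM (regular_const (-1) sub) rf).
  rewrite (bigD1 (Ordinal p0)) //= big1 ?addr0 => [|i ne].
    by rewrite expr0 mulr1 mulN1r (rp y U'y) subrr.
  have [i0|_] := eqVneq (val i) 0%N; last by rewrite mul0r.
  by case/eqP: ne; apply: val_inj.
have [W' [g [oW' W'x rg rE]]] := X_normal Xx oU' neU' rr int.
pose O y := U y /\ W' y.
have oO : open_in X O by apply: open_inI.
have gp y : O y -> g y ^+ p = f y.
  apply: (@regular_eq_dense _ _ _ O U' (fun z => g z ^+ p) f).
  - exact: oO.
  - exact: oU'.
  - by apply: (open_meet oO oU' _ neU'); exists x.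
  - apply: regular_sub (regularX p (fun z => open_in_sub oW') rg).
    by move=> z [].
  - by apply: regular_sub rf => z [].
  by move=> z [Uz W'z] U'z; rewrite -rE // rp.
have [V [d1 [a1 [b1 [oV Vx ha1 hb1 ab1]]]]] := rg x W'x.
exists (fun y => V y /\ W' y), d1, a1, b1; split=> //; first exact: open_inI.
move=> y [Vy W'y] Uy; have [nz gy] := ab1 y Vy W'y; split=> //.
by rewrite -gy; apply: (pcharXn_inj hp); rewrite pth_rootK gp.
Qed.

End PthRoots.

Section Trivialisation.
Variables (k : closedFieldType) (p : nat) (hp : p \in [pchar k]).
Variables (N : nat) (X : variety k N).

Lemma frame_constant_along_curves (V : vbundle X) r
    (u : idx V -> pspace k N -> 'M[k]_(r, rk V))
    (v : idx V -> pspace k N -> 'M[k]_(rk V, r)) :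
  (forall i s t, regular X (chart i) (fun x => u i x s t)) ->
  (forall i s t, regular X (chart i) (fun x => v i x s t)) ->
  (forall i x, chart i x -> u i x *m v i x = 1%:M) ->
  (forall i x, chart i x -> v i x *m u i x = 1%:M) ->
  (forall i j x, chart i x -> chart j x ->
    u i x *m map_mx (fun c => c ^+ p) (trans i j x) = u j x) ->
  forall i,
    (forall s t, constant_along_curves X (chart i) (fun x => u i x s t)) /\
    (forall s t, constant_along_curves X (chart i) (fun x => v i x s t)).
Proof.
move=> ru rv uv vu ut i.
have main delta (d0 : forall t, exists i, (delta i : {poly k}).[t] != 0)
    (gen : generically (fun t => X (curve_point delta (Some t)))) t :
    chart i (curve_point delta (Some t)) ->
    exists (A : 'M_(r, rk V)) (B : 'M_(rk V, r)),
    [/\ germ_mx (fun t => u i (curve_point delta (Some t))) A,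
        germ_mx (fun t => v i (curve_point delta (Some t))) B,
        map_mx (@Dt k) A = 0 & map_mx (@Dt k) B = 0].
  move=> ci.
  have [A [_ hA]] := regular_germ_mx d0 gen (chart_open i) ci (@ru i).
  have [B [_ hB]] := regular_germ_mx d0 gen (chart_open i) ci (@rv i).
  have [DA DB] := frame_deriv0 d0 gen hp ru rv uv vu ut ci hA hB.
  by exists A, B.
have refl (f : k -> k) : generically (fun t => f t = f t).
  by exists 1 => [|t]; rewrite ?oner_neq0.
split=> s t delta d0 gen t0 F /(main _ d0 gen)[A [B [hA hB DA DB]]] hF.
  rewrite (germ_uniq (refl _) hF (hA s t)).
  by have /matrixP/(_ s t) := DA; rewrite !mxE.
rewrite (germ_uniq (refl _) hF (hB s t)).
by have /matrixP/(_ s t) := DB; rewrite !mxE.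
Qed.

Hypotheses (X_normal : normal X) (X_unirational : unirational X).

(** The entrywise [p]-th roots of a trivialisation of the Frobenius pullback and
of its inverse are regular, and satisfy the required identities because their
[p]-th powers do. *)
Lemma frobenius_descent (V : vbundle X) :
  is_trivial (frob_pullback hp V) -> is_trivial V.
Proof.
case: X_unirational => n [phi [n1 phi_map phi_dom phi_sep]].
case=> r [u [v [[ru uc] [rv vc] uv vu]]]; exists r.
have sub i x : @chart _ _ _ V i x -> X x := open_in_sub (chart_open i).
have ru' i s t : regular X (@chart _ _ _ V i) (fun x => u tt i x s t).
  by apply: regular_sub (ru tt i s t) => x ci; split=> //; apply: sub ci.
have rv' i s t : regular X (@chart _ _ _ V i) (fun x => v i tt x s t).
  by apply: regular_sub (rv i tt s t) => x ci; split=> //; apply: sub ci.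
have uc' i j x : @chart _ _ _ V i x -> @chart _ _ _ V j x ->
    u tt i x *m map_mx (pFrobenius_aut hp) (trans i j x) = u tt j x.
  move=> ci cj; have Xx := sub i x ci.
  by have /= <- := uc tt tt i j x Xx Xx ci cj; rewrite mul1mx.
have const i := @frame_constant_along_curves V r (fun i => u tt i)
  (fun i => v i tt) ru' rv'
  (fun i x ci => uv tt i x (sub i x ci) ci)
  (fun i x ci => vu tt i x (sub i x ci) ci) uc' i.
pose root m l (A : 'M[k]_(m, l)) := map_mx (pth_root hp) A.
have rootK m l (A : 'M[k]_(m, l)) : map_mx (pFrobenius_aut hp) (root _ _ A) = A.
  by apply/matrixP => s t; rewrite !mxE; apply: pth_rootK.
have frob_inj m l (A B : 'M[k]_(m, l)) :
    map_mx (pFrobenius_aut hp) A = map_mx (pFrobenius_aut hp) B -> A = B.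
  move=> /matrixP E; apply/matrixP => s t; apply: (pcharXn_inj hp).
  by have := E s t; rewrite !mxE.
exists (fun b i x => root _ _ (u tt i x)), (fun i b x => root _ _ (v i tt x)).
split.
- split=> [b j s t|a b i j x Xx _ ci cj].
    apply: (@regular_sub _ _ _ (@chart _ _ _ V j)); first by move=> x [].
    have h := pth_root_regular hp phi_map phi_dom phi_sep X_normal
      (chart_open j) (ru' j s t) ((const j).1 s t).
    move=> x /h[W [d [a [c [? ? ? ? H]]]]]; exists W, d, a, c.
    by split=> // y Wy Uy; rewrite mxE; apply: H.
  by apply: frob_inj; rewrite /= mul1mx map_mxM !rootK uc'.
- split=> [j b s t|a b i j x ca cb Xx _].
    apply: (@regular_sub _ _ _ (@chart _ _ _ V j)); first by move=> x [].
    have h := pth_root_regular hp phi_map phi_dom phi_sep X_normal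
      (chart_open j) (rv' j s t) ((const j).2 s t).
    move=> x /h[W [d [a [c [? ? ? ? H]]]]]; exists W, d, a, c.
    by split=> // y Wy Uy; rewrite mxE; apply: H.
  apply: frob_inj; rewrite /= mulmx1 map_mxM !rootK.
  by have /= := vc a b tt tt x ca cb Xx Xx; rewrite mulmx1.
- move=> a i x Xx ci; apply: frob_inj.
  by rewrite map_mxM !rootK map_mx1; case: a Xx => Xx; apply: uv.
- move=> a i x Xx ci; apply: frob_inj.
  by rewrite map_mxM !rootK map_mx1; case: a Xx => Xx; apply: vu.
Qed.

Lemma F_trivial_trivial (V : vbundle X) : F_trivial hp V -> is_trivial V.
Proof.
case=> m _; elim: m V => [|m IH] V //=.
by move/frobenius_descent/IH.
Qed.

End Trivialisation.

(** * The local fundamental group scheme *)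

Section LocalFundamentalGroup.
Variables (k : fieldType) (p : nat) (hp : p \in [pchar k]).
Variables (N : nat) (X : variety k N).

Lemma trivial_F_trivial r : F_trivial hp (trivial_bundle X r).
Proof.
exists 1%N => //; exists r.
exists (fun _ _ _ => 1%:M), (fun _ _ _ => 1%:M).
have reg (U : pspace k N -> Prop) (s t : 'I_r) : (forall x, U x -> X x) ->
    regular X U (fun x => (1%:M : 'M[k]_r) s t).
  exact: regular_const.
have f1 : map_mx (fun c => c ^+ p) (1%:M : 'M[k]_r) = 1%:M.
  exact: (map_mx1 (pFrobenius_aut hp)).
split=> [||*|*]; rewrite ?mulmx1 //.
- split=> [b j s t|*]; first by apply: reg => x [].
  by rewrite /= f1 !mulmx1.
- split=> [b j s t|*]; first by apply: reg => x [].
  by rewrite /= f1 !mulmx1.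
Qed.

(** Naturality along the [j]-th coordinate inclusion of the unit object computes
the [j]-th column. *)
Lemma pi_loc_trivial_bundle x (R : comAlgType k) (eta : fibre_family X R) r :
  X x -> pi_loc hp x eta -> eta (trivial_bundle X r) tt = 1%:M.
Proof.
move=> Xx [_ _ nat _ unit]; apply/matrixP => i j.
pose e : bundle_map (trivial_bundle X 1) (trivial_bundle X r) :=
  fun _ _ _ => delta_mx j 0.
have he : is_bundle_map e.
  split=> [b l s t|*]; last by rewrite /= mul1mx mulmx1.
  by apply: regular_const => y [].
have := nat _ _ (trivial_F_trivial 1) (trivial_F_trivial r) e he tt tt Xx Xx.
rewrite unit mulmx1 /fibre_mx /e map_delta_mx => /matrixP/(_ i 0).
rewrite !mxE (bigD1 j) //= big1 ?addr0 => [|l /negPf ne].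
  by rewrite !mxE !eqxx mulr1 andbT.
by rewrite !mxE ne mulr0.
Qed.

(** Conjugating by a trivialisation reduces to the case of a trivial bundle. *)
Lemma pi_loc_trivial_of_trivial :
  (forall V : vbundle X, F_trivial hp V -> is_trivial V) ->
  forall x, X x -> pi_loc_trivial X hp x.
Proof.
move=> triv x Xx R eta h V FV i ci.
have [r [u [v [hu hv uv vu]]]] := triv V FV.
have [_ _ nat _ _] := h.
have := nat V _ FV (trivial_F_trivial r) u hu tt i Xx ci.
rewrite (pi_loc_trivial_bundle r Xx h) mul1mx.
move/(congr1 (mulmx (fibre_mx R (v i tt x)))).
by rewrite mulmxA /fibre_mx -map_mxM vu // map_mx1 mul1mx => <-.
Qed.

End LocalFundamentalGroup.

Theorem theorem3p1p1 (k : closedFieldType) (p : nat) (hp : p \in [pchar k])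
    (N : nat) (X : variety k N) (hnormal : normal X) (huni : unirational X) :
  (forall x : pspace k N, X x -> pi_loc_trivial X hp x) /\
  (forall V : vbundle X, F_trivial hp V -> is_trivial V).
Proof.
have triv := @F_trivial_trivial _ _ hp _ _ hnormal huni.
by split=> //; apply: pi_loc_trivial_of_trivial.
Qed.
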